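(* Let $W$ be a $d'$-dimensional Brownian motion on $[0,T]$ expressed as $W_t=\sum_{(p,m)\in\Lambda}W_{pm}G_{pm}(t)$ and let $W^N_t=\sum_{(p,m)\in\Lambda_N}W_{pm}G_{pm}(t)$ be the truncated Brownian motion, $N\in\mathbb N$. Then for $r>1$, $$c\cdot d'\cdot N^{1/2-\alpha}\cdot2^{(\alpha-1/2)N}\le\mathbb E\Big[\|W-W^N\|_\alpha^r\Big]^{1/r}\le C\cdot d'\cdot\sqrt N\cdot2^{(\alpha-1/2)N},$$ where the constants $c$ and $C$ depend only on $\alpha$ and $r$.
   Context: $T>0$ is fixed, $d'\in\mathbb N$, $\alpha\in(0,1/2)$; $|\cdot|$ is a fixed norm on $\mathbb R^{d'}$. $\|\psi\|_\alpha=\sup_{s\ne t\in[0,T]}|\psi(t)-\psi(s)|/|t-s|^\alpha$ is the $\alpha$-H\''older norm, which is identified (up to equivalence) with the wavelet norm $\sup_{(p,m)\in\Lambda}2^{(\alpha-1/2)p}|\psi_{pm}|$, $\psi_{pm}=\int_0^TH_{pm}\,d\psi$. $\Lambda=\{(0,0)\}\cup\{(p,m):p\in\mathbb N_0,1\le m\le2^p\}$, $\Lambda_N=\{(p,m)\in\Lambda:p\le N\}$. Haar functions: $H_{00}=T^{-1/2}$; $H_{pm}=\sqrt{2^p/T}$ on $[\frac{(m-1)T}{2^p},\frac{(2m-1)T}{2^{p+1}})$, $-\sqrt{2^p/T}$ on $[\frac{(2m-1)T}{2^{p+1}},\frac{mT}{2^p})$, $0$ elsewhere. Schauder functions: $G_{pm}(t)=\int_0^tH_{pm}(s)\,ds$.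 The $W_{pm}=\int H_{pm}\,dW$ are i.i.d. standard normal vectors in $\mathbb R^{d'}$.
   Formalization: The constant c may also depend on d' and on the norm (a lower bound with c independent of d' is false, e.g. for the l^1 norm as d' grows), and both c and C may depend on T; C is independent of d' for norms bounded by a given K on the unit vectors; N is at least 1. *)

(* Defs.v *)
From HB Require Import structures.
From mathcomp Require Import all_boot all_order all_algebra.
From mathcomp Require Import all_classical all_reals all_analysis.

Set Implicit Arguments.
Unset Strict Implicit.
Unset Printing Implicit Defensive.

Import Order.TTheory GRing.Theory Num.Theory.
Import numFieldNormedType.Exports.

Local Open Scope classical_set_scope.
Local Open Scope ring_scope.

Definition is_norm (R : realType) (d : nat) (nrm : 'rV[R]_d -> R) : Prop :=
  [/\ forall x y, nrm (x + y) <= nrm x + nrm y,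
      forall (a : R) x, nrm (a *: x) = `|a| * nrm x
    & forall x, nrm x = 0 -> x = 0].

(* Extended-real valued: the supremum is +oo when psi is not Hoelder. *)
Definition holder_norm (R : realType) (d : nat) (nrm : 'rV[R]_d -> R)
    (T alpha : R) (psi : R -> 'rV[R]_d) : \bar R :=
  ereal_sup [set x | exists s t : R,
    [/\ s \in `[0, T], t \in `[0, T], s != t
      & x = (nrm (psi t - psi s) / `|t - s| `^ alpha)%:E]].

(* Indices (p, m) : nat * nat; (0, 0) is the constant function, and all other
   indices in use have 1 <= m <= 2 ^ p. *)
Definition Lambda_trunc (N : nat) : seq (nat * nat) :=
  (0, 0)%N :: [seq (p, m) | p <- iota 0 N.+1, m <- iota 1 (2 ^ p)].

Definition dyadic_left (R : realType) (T : R) (q : nat * nat) : R :=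
  (q.2.-1)%:R * T / 2 ^+ q.1.
Definition dyadic_mid (R : realType) (T : R) (q : nat * nat) : R :=
  (q.2.*2.-1)%:R * T / 2 ^+ q.1.+1.
Definition dyadic_right (R : realType) (T : R) (q : nat * nat) : R :=
  q.2%:R * T / 2 ^+ q.1.

Definition haar (R : realType) (T : R) (q : nat * nat) (s : R) : R :=
  if q == (0, 0)%N then (Num.sqrt T)^-1
  else if dyadic_left T q <= s < dyadic_mid T q then Num.sqrt (2 ^+ q.1 / T)
  else if dyadic_mid T q <= s < dyadic_right T q then - Num.sqrt (2 ^+ q.1 / T)
  else 0.

Definition schauder (R : realType) (T : R) (q : nat * nat) (t : R) : R :=
  \int[lebesgue_measure]_(s in `[0, t]) haar T q s.

(* The integral of haar T q against d psi on [0, T]: haar T q is a step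
   function, so this is the sum of its values times the increments of psi. *)
Definition haar_coef (R : realType) (d : nat) (T : R) (psi : R -> 'rV[R]_d)
    (q : nat * nat) : 'rV[R]_d :=
  if q == (0, 0)%N then (Num.sqrt T)^-1 *: (psi T - psi 0)
  else Num.sqrt (2 ^+ q.1 / T) *:
    ((psi (dyadic_mid T q) - psi (dyadic_left T q))
     - (psi (dyadic_right T q) - psi (dyadic_mid T q))).

Definition schauder_trunc (R : realType) (d : nat) (T : R)
    (psi : R -> 'rV[R]_d) (N : nat) (t : R) : 'rV[R]_d :=
  \sum_(q <- Lambda_trunc N) schauder T q t *: haar_coef T psi q.

(* The product rule over the whole family gives it for every subfamily: take
   B i = setT for the other indices. *)
Definition mutually_independent (R : realType) (disp : measure_display)
    (Omega : measurableType disp) (P : probability Omega R) (I : finType)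
    (X : I -> Omega -> R) : Prop :=
  forall B : I -> set R, (forall i, measurable (B i)) ->
    P [set w | forall i, B i (X i w)] = (\prod_i P (X i @^-1` B i))%E.

(* In bm_indep independence is over time steps and coordinates jointly; with
   bm_gauss this says that increments over disjoint intervals are independent
   and that W t - W s is a N(0, (t - s) I_d) vector.  The second argument of
   normal_prob is the standard deviation. *)
Record is_brownian_motion (R : realType) (disp : measure_display)
    (Omega : measurableType disp) (P : probability Omega R) (d : nat) (T : R)
    (W : R -> Omega -> 'rV[R]_d) : Prop := {
  bm_meas : forall t i, t \in `[0, T] ->
    measurable_fun setT (fun w => W t w ord0 i);
  bm_init : {ae P, forall w, W 0 w = 0};
  bm_gauss : forall s t i, 0 <= s -> s < t -> t <= T ->
    forall B : set R, measurable B ->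
    P [set w | B (W t w ord0 i - W s w ord0 i)]
      = normal_prob 0 (Num.sqrt (t - s)) B;
  bm_indep : forall (n : nat) (t : nat -> R),
    0 <= t 0%N -> t n <= T ->
    (forall k, (k < n)%N -> t k < t k.+1) ->
    mutually_independent P (fun (ki : 'I_n * 'I_d) w =>
      W (t ki.1.+1) w ord0 ki.2 - W (t ki.1) w ord0 ki.2);
  bm_cont : {ae P, forall w, {within `[0, T], continuous (fun t => W t w)}}
}.

(* Main.v *)
Require Import Defs.
From HB Require Import structures.
From mathcomp Require Import all_boot all_order all_algebra.
From mathcomp Require Import all_classical all_reals all_analysis.
From mathcomp Require Import measurable_realfun ring lra zify.

Set Implicit Arguments.
Unset Strict Implicit.
Unset Printing Implicit Defensive.

Import Order.TTheory GRing.Theory Num.Theory.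
Import numFieldNormedType.Exports.

Local Open Scope classical_set_scope.
Local Open Scope ring_scope.

(** The Haar coefficients of a Brownian path are standard normal, and the Hoelder
    norm of the tail [W - W^N] is comparable with a weighted supremum of the
    coefficients of the levels [p > N], with weight [2 `^ ((alpha - 1 / 2) * p)].
    Both bounds follow from the size of the largest of the [2 ^ p] coefficients
    of level [p], which is of order [sqrt p].

    Upper bound.  The Schauder functions of a level are tents with disjoint
    supports, so the increments of a level are controlled by its largest
    coefficient ([sum_schauder_incr_le]).  Summing over the levels gives
    a deterministic estimate ([holder_norm_tail_le]): if all coefficients of all
    levels [p > 0] are at most [sqrt p * U], then the Hoelder norm of the tail is
    at most a constant times [U * sqrt N * 2 `^ ((alpha - 1 / 2) * N)].  A random
    [U] with finite [r]-th moment, the same for all [p] and hence for all [N],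
    is obtained from Gaussian exponential moments: the [r]-th power of
    [x / sqrt p] is at most a constant plus a constant times
    [4 ^- p * expR (x ^+ 2 / 4)] ([powR_div_sqrt_le]), and the sum of these terms
    over the [2 ^ p.+1] increments of each level and over all levels is
    integrable ([integral_sup_incr_bound_le]).  The power-mean inequality over the
    coordinates makes the dimension appear to the first power.

    Lower bound.  The truncation is affine on the dyadic intervals of level
    [N.+1], so the coefficients of that level are those of [W]
    ([haar_coef_tail]), and each of them is dominated by the Hoelder norm
    ([holder_norm_ge_coef]).  By independence and a Gaussian tail estimate, with
    probability bounded below one of the [2 ^ N.+1] coefficients is at least
    [sqrt N / 4] ([probability_large_coef]); finally
    [N `^ (1 / 2 - alpha) <= sqrt N]. *)

(** * Schauder functions *)

Section deterministic_bounds.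
Context {R : realType}.
Implicit Types (T a b s t x y : R) (p m N : nat).

Local Notation pos x := (Num.max x 0).

Lemma measure_itv_inter_Icc a b t : 0 <= a <= b ->
  fine (lebesgue_measure (`[a, b[ `&` `[0%R, t] : set R))
  = pos (t - a) - pos (t - b).
Proof.
move=> /andP[a0 ab].
have [ta|at_] := ltP t a.
  rewrite (_ : _ `&` _ = set0); last first.
    rewrite -subset0 => x /= []; rewrite !in_itv /= => /andP[ax _] /andP[_ xt].
    by have := lt_le_trans ta (le_trans ax xt); rewrite ltxx.
  rewrite measure0 /= !max_r ?subrr//; lra.
have [tb|bt] := ltP t b.
  rewrite (_ : _ `&` _ = [set` `[a, t]]); last first.
    apply/seteqP; split => x /=; rewrite !in_itv /=.
      by move=> [/andP[-> _] /andP[_ ->]].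
    by move=> /andP[ax xt]; rewrite ax xt (le_lt_trans xt tb) (le_trans a0 ax).
  rewrite lebesgue_measure_itv/= lte_fin (@max_r _ _ (t - b)); last lra.
  rewrite max_l ?subr_ge0// subr0; case: ifPn => //=.
  by rewrite -leNgt => ta; lra.
rewrite (_ : _ `&` _ = [set` `[a, b[]); last first.
  apply/seteqP; split => x /=; rewrite !in_itv /=; first by case.
  by move=> /andP[ax xb]; rewrite ax xb (le_trans a0 ax) (ltW (lt_le_trans xb bt)).
rewrite lebesgue_measure_itv/= lte_fin !max_l ?subr_ge0//.
case: ifPn => /=; first by move=> _; ring.
by rewrite -leNgt => ba; lra.
Qed.

Lemma Rintegral_indic_itv a b t : 0 <= a <= b ->
  \int[lebesgue_measure]_(s in `[0, t]) (\1_`[a, b[ s : R)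
  = pos (t - a) - pos (t - b).
Proof. by move=> ab; rewrite /Rintegral integral_indic// measure_itv_inter_Icc. Qed.

Lemma schauder00E T t : 0 <= t -> schauder T (0, 0)%N t = (Num.sqrt T)^-1 * t.
Proof.
move=> t0; rewrite /schauder /haar eqxx Rintegral_cst//= lebesgue_measure_itv/=.
rewrite lte_fin; case: ifPn => /=; first by rewrite subr0.
by rewrite -leNgt => t0'; congr (_ * _); apply/eqP; rewrite eq_le t0 t0'.
Qed.

(** The tent with feet [l] and [l + 2 * e] and slopes 1 and -1. *)
Definition tent (l e t : R) : R :=
  pos (t - l) - pos (t - (l + e)) - (pos (t - (l + e)) - pos (t - (l + e *+ 2))).

Lemma dyadic_leftE T p j : dyadic_left T (p, j.+1) = j%:R * (T / 2 ^+ p).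
Proof. by rewrite /dyadic_left /= mulrA. Qed.

Lemma dyadic_midE T p j :
  dyadic_mid T (p, j.+1) = j%:R * (T / 2 ^+ p) + T / 2 ^+ p.+1.
Proof.
have e0 : 2 ^+ p != 0 :> R by rewrite expf_neq0.
rewrite /dyadic_mid /= -addn1 natrD -muln2 natrM exprS.
by field; rewrite e0.
Qed.

Lemma dyadic_rightE T p j :
  dyadic_right T (p, j.+1) = j%:R * (T / 2 ^+ p) + (T / 2 ^+ p.+1) *+ 2.
Proof.
have e0 : 2 ^+ p != 0 :> R by rewrite expf_neq0.
rewrite /dyadic_right /= -natr1 exprS.
by field; rewrite e0.
Qed.

Lemma haar_indic T p j s : 0 < T ->
  haar T (p, j.+1) s = Num.sqrt (2 ^+ p / T) *
    (\1_`[dyadic_left T (p, j.+1), dyadic_mid T (p, j.+1)[ s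
     - \1_`[dyadic_mid T (p, j.+1), dyadic_right T (p, j.+1)[ s).
Proof.
move=> T0; rewrite /haar xpair_eqE andbF !indicE.
rewrite !mem_setE !in_itv /=.
case: ifPn => [/andP[_ sm]|_]; last by case: ifPn; rewrite /=; lra.
by rewrite leNgt sm /=; lra.
Qed.

Lemma schauderE T p j t : 0 < T ->
  schauder T (p, j.+1) t =
    Num.sqrt (2 ^+ p / T) * tent (j%:R * (T / 2 ^+ p)) (T / 2 ^+ p.+1) t.
Proof.
move=> T0; rewrite /schauder.
have d0 q : 0 <= T / 2 ^+ q :> R by rewrite divr_ge0 ?exprn_ge0 ?ltW.
have l0 : 0 <= j%:R * (T / 2 ^+ p) :> R by rewrite mulr_ge0.
under eq_Rintegral do rewrite haar_indic//.
have I a b : lebesgue_measure.-integrable `[0, t] (EFin \o (\1_`[a, b[ : R -> R)).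
  by apply: integrableS (integrable_indic_itv a b true true).
rewrite RintegralZl//; last first.
  have := @integrableB _ _ R (@lebesgue_measure R) _ _ _ _
    (I (dyadic_left T (p, j.+1)) (dyadic_mid T (p, j.+1)))
    (I (dyadic_mid T (p, j.+1)) (dyadic_right T (p, j.+1))).
  by apply; exact: measurable_itv.
rewrite RintegralB//.
rewrite !Rintegral_indic_itv; last 2 first.
- rewrite dyadic_midE dyadic_rightE addr_ge0//= lerD2l mulr2n.
  by have := d0 p.+1; lra.
- by rewrite dyadic_leftE dyadic_midE l0/= lerDl.
by rewrite dyadic_leftE dyadic_midE dyadic_rightE.
Qed.

Lemma tent_ge0 l e t : 0 <= e -> 0 <= tent l e t.
Proof.
rewrite /tent mulr2n => e0.
by case: (leP (t - l) 0); case: (leP (t - (l + e)) 0);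
  case: (leP (t - (l + (e + e))) 0); lra.
Qed.

Lemma tent_le l e t : 0 <= e -> tent l e t <= e.
Proof.
rewrite /tent mulr2n => e0.
by case: (leP (t - l) 0); case: (leP (t - (l + e)) 0);
  case: (leP (t - (l + (e + e))) 0); lra.
Qed.

Lemma pos_incr_le b c s t : s <= t -> b <= c ->
  0 <= pos (t - c) - pos (s - c) <= pos (t - b) - pos (s - b).
Proof.
move=> st bc; apply/andP; split; case: (leP (t - c) 0); case: (leP (s - c) 0);
  case: (leP (t - b) 0); case: (leP (s - b) 0); lra.
Qed.

Lemma tent_lip l e s t : 0 <= e -> `|tent l e t - tent l e s| <= `|t - s|.
Proof.
move=> e0; wlog st : s t / s <= t.
  move=> H; have [/H//|/ltW/H] := leP s t.
  by rewrite distrC (distrC s).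
have /(pos_incr_le st)/andP[] : l <= l + e by lra.
have /(pos_incr_le st)/andP[] : l + e <= l + e *+ 2 by lra.
have : pos (t - l) - pos (s - l) <= t - s.
  by case: (leP (t - l) 0); case: (leP (s - l) 0); lra.
rewrite (ger0_norm (_ : 0 <= t - s)) ?subr_ge0// ler_norml /tent => *.
by apply/andP; split; lra.
Qed.

Lemma tent_out l e t : 0 <= e -> ~~ (l <= t < l + e *+ 2) -> tent l e t = 0.
Proof.
rewrite /tent mulr2n negb_and -ltNge -leNgt => e0 /orP[] ?;
case: (leP (t - l) 0); case: (leP (t - (l + e)) 0);
  case: (leP (t - (l + (e + e))) 0); lra.
Qed.
(** Interpolation between the two natural bounds for an increment: the length of
    the time interval and the step of the grid. *)
Lemma le_geometric_mean x d (al : R) : 0 <= x -> 0 < d -> 0 < al < 1 ->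
  Num.min x d <= x `^ al * d `^ (1 - al).
Proof.
move=> x0 d0 /andP[al0 al1].
have split1 y : 0 <= y -> y = y `^ al * y `^ (1 - al).
  move=> y0; rewrite -powRD; last by apply/implyP => /eqP; lra.
  by rewrite (_ : al + (1 - al) = 1) ?powRr1//; ring.
have [xd|dx] := leP x d.
  rewrite {1}(split1 _ x0) ler_wpM2l ?powR_ge0// ge0_ler_powR ?nnegrE ?(ltW d0)//.
  by lra.
rewrite {1}(split1 _ (ltW d0)) ler_wpM2r ?powR_ge0//.
by rewrite ge0_ler_powR ?nnegrE ?(ltW d0) ?(ltW al0)// (ltW dx).
Qed.

Lemma haar_heightE T p : 0 < T ->
  Num.sqrt (2 ^+ p / T) = (T / 2 ^+ p) `^ (- 2^-1).
Proof.
move=> T0; have d0 : 0 <= T / 2 ^+ p by rewrite divr_ge0 ?exprn_ge0 ?ltW.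
by rewrite powRN powR12_sqrt// -sqrtrV// invf_div.
Qed.

Lemma sum_eq_ord (n k : nat) :
  \sum_(j < n) ((j : nat) == k)%:R = (k < n)%:R :> R.
Proof.
elim: n => [|n IH]; first by rewrite big_ord0.
rewrite big_ord_recr /= IH ltnS [in RHS]leq_eqVlt [n == k]eq_sym.
by have [->|_] := eqVneq k n; rewrite ?ltnn ?add0r ?addr0.
Qed.

Lemma tent_support T p j t : 0 < T -> 0 <= t ->
  j != Num.truncn (t / (T / 2 ^+ p)) ->
  tent (j%:R * (T / 2 ^+ p)) (T / 2 ^+ p.+1) t = 0.
Proof.
move=> T0 t0 jt.
have d0 q : 0 < T / 2 ^+ q :> R by rewrite divr_gt0 ?exprn_gt0.
apply: tent_out; first exact: ltW.
apply: contra jt => /andP[jlet tltj]; rewrite eq_sym (truncn_eq _ (divr_ge0 t0 (ltW (d0 _)))).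
rewrite ler_pdivlMr// jlet/= ltr_pdivrMr//; apply: (lt_le_trans tltj).
rewrite -[j.+1%:R]natr1 mulrDl mul1r lerD2l exprS.
have e0 : 2 ^+ p != 0 :> R by rewrite expf_neq0.
by rewrite (_ : _ *+ 2 = T / 2 ^+ p)//; field.
Qed.

(** At level [p] the Schauder functions are tents of height [Num.sqrt T] times
    [2 `^ (- p / 2 - 1)] with disjoint supports, so at most one of them is
    nonzero at [s] and at most one at [t]; each increment is controlled both by
    the height and by the slope, and the exponent [alpha] interpolates. *)
Lemma sum_schauder_incr_le T (alpha : R) p s t : 0 < T -> 0 < alpha < 1 ->
  0 <= s -> 0 <= t ->
  \sum_(j < 2 ^ p) `|schauder T (p, j.+1) t - schauder T (p, j.+1) s|
  <= ((T / 2 ^+ p) `^ (1 / 2 - alpha) * `|t - s| `^ alpha) *+ 2.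
Proof.
move=> T0 al s0 t0; set d := T / 2 ^+ p; set h := Num.sqrt (2 ^+ p / T).
have d0 : 0 < d by rewrite divr_gt0 ?exprn_gt0.
have d20 : 0 < T / 2 ^+ p.+1 by rewrite divr_gt0 ?exprn_gt0.
have hE : h = d `^ (- 2^-1) by exact: haar_heightE.
set b := h * Num.min `|t - s| d.
have b_ge0 : 0 <= b by rewrite mulr_ge0 ?sqrtr_ge0// le_min normr_ge0 ltW.
have bd : b <= d `^ (1 / 2 - alpha) * `|t - s| `^ alpha.
  apply: (le_trans (ler_wpM2l (sqrtr_ge0 _) (le_geometric_mean (normr_ge0 _) d0 al))).
  rewrite -/h hE mulrCA -powRD; last by rewrite (gt_eqF d0) implybT.
  by rewrite mulrC (_ : - 2^-1 + (1 - alpha) = 1 / 2 - alpha)//; field.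
apply: (@le_trans _ _ (b *+ 2)); last by rewrite lerMn2r.
(* The index of the dyadic interval of level p that contains x. *)
pose f x := Num.truncn (x / d).
apply: (@le_trans _ _ (\sum_(j < 2 ^ p)
    (b * ((j : nat) == f t)%:R + b * ((j : nat) == f s)%:R))); last first.
  rewrite big_split/= -!mulr_sumr !sum_eq_ord mulr2n.
  by apply: lerD; rewrite ler_piMr// lern1 leq_b1.
apply: ler_sum => j _; rewrite !schauderE// -mulrBr normrM (ger0_norm (sqrtr_ge0 _)).
rewrite -/h -/d.
have incr_b : h * `|tent (j%:R * d) (T / 2 ^+ p.+1) t
                   - tent (j%:R * d) (T / 2 ^+ p.+1) s| <= b.
  rewrite ler_wpM2l ?sqrtr_ge0// le_min tent_lip ?(ltW d20)//=.
  have le_d : T / 2 ^+ p.+1 <= d.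
    by rewrite ler_pM2l// lef_pV2 ?posrE ?exprn_gt0// ler_weXn2l// ler1n.
  apply: le_trans le_d; rewrite ler_norml.
  have := (tent_ge0 (j%:R * d) t (ltW d20), tent_le (j%:R * d) t (ltW d20)).
  have := (tent_ge0 (j%:R * d) s (ltW d20), tent_le (j%:R * d) s (ltW d20)).
  by move=> [? ?] [? ?]; lra.
have [jt|jt] := eqVneq (j : nat) (f t).
  by rewrite mulr1; apply: le_trans incr_b _; rewrite lerDl mulr_ge0.
have [js|js] := eqVneq (j : nat) (f s).
  by rewrite mulr1; apply: le_trans incr_b _; rewrite lerDr mulr_ge0.
by rewrite !tent_support// subrr normr0 !mulr0 addr0.
Qed.

(** The positive part of a translate bends only at a node of the grid of mesh
    [c *+ 2], hence not inside a cell. *)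
Lemma pos_midpoint (i k : nat) (c : R) : 0 <= c ->
  pos (k%:R * (c *+ 2) + c - i%:R * (c *+ 2)) - pos (k%:R * (c *+ 2) - i%:R * (c *+ 2))
  = pos (k%:R * (c *+ 2) + c *+ 2 - i%:R * (c *+ 2))
    - pos (k%:R * (c *+ 2) + c - i%:R * (c *+ 2)).
Proof.
move=> c0; have c20 : 0 <= c *+ 2 by rewrite mulrn_wge0.
have [ik|ki] := leqP i k.
  have : i%:R * (c *+ 2) <= k%:R * (c *+ 2) by rewrite ler_wpM2r// ler_nat.
  by rewrite mulr2n => ?; rewrite !max_l; lra.
have : k.+1%:R * (c *+ 2) <= i%:R * (c *+ 2) by rewrite ler_wpM2r// ler_nat.
by rewrite -[k.+1%:R]natr1 mulrDl mul1r mulr2n => ?; rewrite !max_r; lra.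
Qed.

Lemma dyadic_refine T p q (i : nat) : (p <= q)%N ->
  i%:R * (T / 2 ^+ p) = (i * 2 ^ (q - p))%N%:R * (T / 2 ^+ q).
Proof.
move=> pq; rewrite natrM natrX -{2}(subnK pq) exprD.
have e0 k : 2 ^+ k != 0 :> R by rewrite expf_neq0.
by field; rewrite !e0.
Qed.

(** The breakpoints of a Schauder function are nodes of every finer grid, so it
    is affine on each finer dyadic interval. *)
Lemma schauder_midpoint T p j N k : 0 < T -> (p <= N)%N ->
  schauder T (p, j.+1) (dyadic_mid T (N.+1, k.+1))
  - schauder T (p, j.+1) (dyadic_left T (N.+1, k.+1))
  = schauder T (p, j.+1) (dyadic_right T (N.+1, k.+1))
    - schauder T (p, j.+1) (dyadic_mid T (N.+1, k.+1)).
Proof.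
move=> T0 pN; rewrite !schauderE// -!mulrBr; congr (_ * _).
rewrite dyadic_midE dyadic_leftE dyadic_rightE.
set c := T / 2 ^+ N.+2.
have c0 : 0 <= c by rewrite divr_ge0 ?exprn_ge0 ?(ltW T0).
have cE : T / 2 ^+ N.+1 = c *+ 2.
  have e0 : 2 ^+ N != 0 :> R by rewrite expf_neq0.
  by rewrite /c !exprS; field.
have [i1 E1] : exists i : nat, j%:R * (T / 2 ^+ p) = i%:R * (c *+ 2).
  by eexists; rewrite -cE; apply: dyadic_refine; lia.
have [i2 E2] : exists i : nat, T / 2 ^+ p.+1 = i%:R * (c *+ 2).
  eexists; rewrite -cE -[LHS]mul1r; apply: (@dyadic_refine _ _ _ 1); lia.
rewrite cE /tent E1 E2.
have H i := @pos_midpoint i k c c0.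
have := H i1; have := H (i1 + i2)%N; have := H (i1 + i2 * 2)%N.
rewrite !natrD natrM -(mulr_natr (i2%:R * _)) ![_ * 2]mulrC !mulrDl mulrA.
lra.
Qed.
(** * Haar coefficients of a truncated expansion *)

Lemma big_Lambda_trunc (V : nmodType) N (F : nat * nat -> V) :
  \sum_(q <- Lambda_trunc N) F q
  = F (0, 0)%N + \sum_(0 <= p < N.+1) \sum_(j < 2 ^ p) F (p, j.+1).
Proof.
rewrite /Lambda_trunc big_cons; congr (_ + _).
rewrite big_allpairs_dep /index_iota subn0; apply: eq_bigr => p _.
rewrite -[1%N]addn0 iotaDl big_map -(big_mkord xpredT (fun j => F (p, j.+1))).
by rewrite /index_iota subn0.
Qed.

Section vector_valued.
Variable d : nat.
Implicit Types psi : R -> 'rV[R]_d.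

Lemma schauder_truncE T psi N t :
  schauder_trunc T psi N t = schauder T (0, 0)%N t *: haar_coef T psi (0, 0)%N
  + \sum_(0 <= p < N.+1) \sum_(j < 2 ^ p)
      schauder T (p, j.+1) t *: haar_coef T psi (p, j.+1).
Proof. exact: big_Lambda_trunc. Qed.

Lemma dyadic_itv T p j : 0 < T -> (j < 2 ^ p)%N ->
  [/\ 0 <= dyadic_left T (p, j.+1),
      dyadic_mid T (p, j.+1) = dyadic_left T (p, j.+1) + T / 2 ^+ p.+1,
      dyadic_right T (p, j.+1) = dyadic_mid T (p, j.+1) + T / 2 ^+ p.+1
    & dyadic_right T (p, j.+1) <= T].
Proof.
move=> T0 jp; rewrite dyadic_leftE dyadic_midE dyadic_rightE; split => //.
- by rewrite mulr_ge0// divr_ge0 ?exprn_ge0 ?ltW.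
- by rewrite mulr2n addrA.
rewrite -dyadic_rightE /dyadic_right /= ler_pdivrMr ?exprn_gt0// mulrC.
by rewrite ler_wpM2l ?(ltW T0)// -natrX ler_nat.
Qed.

Lemma schauder_trunc_midpoint T psi N k : 0 < T -> (k < 2 ^ N.+1)%N ->
  schauder_trunc T psi N (dyadic_mid T (N.+1, k.+1))
  - schauder_trunc T psi N (dyadic_left T (N.+1, k.+1))
  = schauder_trunc T psi N (dyadic_right T (N.+1, k.+1))
    - schauder_trunc T psi N (dyadic_mid T (N.+1, k.+1)).
Proof.
move=> T0 kN; rewrite !schauder_truncE.
have [l0 mE rE _] := dyadic_itv T0 kN.
have e0 : 0 < T / 2 ^+ N.+2 by rewrite divr_gt0 ?exprn_gt0.
have midD (V : zmodType) (a1 a2 a3 b1 b2 b3 : V) : a2 - a1 = a3 - a2 ->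
    b2 - b1 = b3 - b2 -> a2 + b2 - (a1 + b1) = a3 + b3 - (a2 + b2).
  move=> a123 b123; rewrite opprD [- (a2 + b2)]opprD addrACA a123 b123.
  by rewrite addrACA.
apply: midD.
  rewrite -!scalerBl !schauder00E; [|lra..].
  by congr (_ *: _); rewrite rE mE; lra.
rewrite -!sumrB big_nat [RHS]big_nat; apply: eq_bigr => p /andP[_ pN].
rewrite -!sumrB; apply: eq_bigr => j _.
by rewrite -!scalerBl schauder_midpoint.
Qed.

(** The truncation is affine on each dyadic interval of level [N.+1], so its
    increments on the two halves agree and cancel in the Haar coefficient. *)
Lemma haar_coef_tail T psi N k : 0 < T -> (k < 2 ^ N.+1)%N ->
  haar_coef T (fun t => psi t - schauder_trunc T psi N t) (N.+1, k.+1)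
  = haar_coef T psi (N.+1, k.+1).
Proof.
move=> T0 kN; rewrite /haar_coef xpair_eqE andbF /=; congr (_ *: _).
have subB (V : zmodType) (a b c e : V) : a - b - (c - e) = (a - c) - (b - e).
  by rewrite !opprB [e - c]addrC [e - b]addrC addrACA.
rewrite !(subB _ (psi _) (schauder_trunc _ _ _ _)) schauder_trunc_midpoint//.
by rewrite [LHS]subB subrr subr0.
Qed.

End vector_valued.

(** * Norms on row vectors *)

Section norms_on_row_vectors.
Variables (d : nat) (nrm : 'rV[R]_d -> R).
Hypothesis nrmP : is_norm nrm.
Implicit Types (u v : 'rV[R]_d) (psi : R -> 'rV[R]_d).

Let nrmD u v : nrm (u + v) <= nrm u + nrm v. Proof. by case: nrmP. Qed.
Let nrmZ (a : R) u : nrm (a *: u) = `|a| * nrm u. Proof. by case: nrmP. Qed.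

Lemma is_norm0 : nrm 0 = 0.
Proof. by rewrite -(scale0r (0 : 'rV[R]_d)) nrmZ normr0 mul0r. Qed.

Lemma is_normN u : nrm (- u) = nrm u.
Proof. by rewrite -scaleN1r nrmZ normrN1 mul1r. Qed.

Lemma is_norm_ge0 u : 0 <= nrm u.
Proof.
by have := nrmD u (- u); rewrite subrr is_norm0 is_normN -mulr2n pmulrn_lge0.
Qed.

Lemma is_normB u v : nrm (u - v) <= nrm u + nrm v.
Proof. by rewrite (le_trans (nrmD _ _))// is_normN. Qed.

Lemma is_norm_sum (I : Type) (r : seq I) (P : pred I) (F : I -> 'rV[R]_d) :
  nrm (\sum_(i <- r | P i) F i) <= \sum_(i <- r | P i) nrm (F i).
Proof.
elim/big_ind2 : _ => //; first by rewrite is_norm0.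
by move=> u a v b ua vb; rewrite (le_trans (nrmD _ _))// lerD.
Qed.

Lemma is_norm_le_coord (K : R) u :
  (forall i : 'I_d, nrm (delta_mx ord0 i) <= K) ->
  nrm u <= K * \sum_i `|u ord0 i|.
Proof.
move=> nrmK; rewrite {1}[u]row_sum_delta (le_trans (is_norm_sum _ _ _))//.
rewrite mulr_sumr ler_sum// => i _; rewrite nrmZ mulrC.
by rewrite ler_wpM2r.
Qed.

Lemma coord_le_norm u i : `|u ord0 i| <= `|u|.
Proof.
rewrite [leRHS]/Num.norm /= mx_normrE.
exact: (@le_bigmax _ _ _ 0 (fun ij => `|u ij.1 ij.2|) (ord0, i)).
Qed.

Lemma is_norm_le_norm (K : R) u :
  (forall i : 'I_d, nrm (delta_mx ord0 i) <= K) ->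
  nrm u <= K * d%:R * `|u|.
Proof.
move=> nrmK; case: (posnP d) => [d0|d0].
  have -> : u = 0 by apply/rowP => i; exfalso;
    move: (leq_ltn_trans (leq0n i) (ltn_ord i)); rewrite d0.
  by rewrite is_norm0 normr0 mulr0.
have K0 : 0 <= K by apply: le_trans (nrmK (Ordinal d0)); exact: is_norm_ge0.
rewrite (le_trans (is_norm_le_coord u nrmK))// -mulrA ler_wpM2l//.
rewrite (le_trans (ler_sum _ (fun i _ => coord_le_norm u i)))//.
by rewrite sumr_const card_ord mulr_natl.
Qed.

(** The minimum of a norm over the compact unit sphere of the sup norm is
    positive; this is the only place where the constant of the lower bound
    depends on the norm. *)
Lemma is_norm_coord_lower :
  exists2 c : R, 0 < c & forall u i, c * `|u ord0 i| <= nrm u.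
Proof.
case: (posnP d) => [d0|d0].
  by exists 1 => // u i; exfalso; move: (leq_ltn_trans (leq0n i) (ltn_ord i)); rewrite d0.
pose K := \sum_i nrm (delta_mx ord0 i).
have nrmK i : nrm (delta_mx ord0 i) <= K.
  by rewrite /K (bigD1 i)//= lerDl sumr_ge0// => j _; exact: is_norm_ge0.
pose L := K * d%:R + 1.
have L0 : 0 < L.
  by rewrite ltr_wpDl// mulr_ge0// sumr_ge0// => j _; exact: is_norm_ge0.
have nrmL u : nrm u <= L * `|u|.
  by rewrite (le_trans (is_norm_le_norm u nrmK))// ler_wpM2r// lerDl.
pose S := [set u : 'rV[R]_d | `|u| = 1].
have Sc : compact S.
  apply: bounded_closed_compact.
    by exists 1; split => // x x1 u /= ->; exact: ltW.
  apply: (@closed_comp _ _ (fun u : 'rV[R]_d => `|u|) [set (1 : R)]).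
    by move=> u _; exact: norm_continuous.
  exact: closed_eq.
have S0 : S !=set0.
  pose u : 'rV[R]_d := delta_mx ord0 (Ordinal d0).
  have u0 : `|u| != 0.
    rewrite normr_eq0; apply/eqP => /rowP/(_ (Ordinal d0)).
    by rewrite !mxE !eqxx => /eqP; rewrite oner_eq0.
  by exists (`|u|^-1 *: u); rewrite /S /= normrZ normfV normr_id mulVf.
have nrmc : continuous nrm.
  move=> u; apply/(@cvgrPdist_lt _ _ _ (nbhs u) (nbhs_filter u)) => e e0.
  apply/nbhs_ballP; exists (e / L) => /=; first exact: divr_gt0.
  move=> v; rewrite mx_norm_ball /ball_ /= => uv; apply: (@le_lt_trans _ _ (nrm (u - v))).
    rewrite ler_norml; apply/andP; split.
      by rewrite lerNl opprB lerBlDr; have := nrmD (- (u - v)) u; rewrite is_normN opprB subrK.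
    by rewrite lerBlDr -{1}(subrK v u) nrmD.
  by rewrite (le_lt_trans (nrmL _))// mulrC -ltr_pdivlMr.
have [m mS mmin] := EVT_min_rV S0 Sc (continuous_subspaceT nrmc).
have m0 : 0 < nrm m.
  rewrite lt_neqAle is_norm_ge0 andbT eq_sym; apply/eqP => m0.
  have [_ _ /(_ _ m0) m00] := nrmP.
  by move: mS; rewrite inE /S /= m00 normr0 => /eqP; rewrite eq_sym oner_eq0.
exists (nrm m) => // u i.
rewrite (le_trans (ler_wpM2l (ltW m0) (coord_le_norm u i)))//.
have [->|u0] := eqVneq u 0; first by rewrite normr0 mulr0 is_norm0.
have un0 : `|u| != 0 by rewrite normr_eq0.
have : nrm m <= nrm (`|u|^-1 *: u).
  by apply: mmin; rewrite inE /S /= normrZ normfV normr_id mulVf.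
by rewrite nrmZ normfV normr_id ler_pdivlMl ?normr_gt0// mulrC.
Qed.

End norms_on_row_vectors.

(** * Hoelder norms and Haar coefficients *)

Lemma ratio_lt1 (alpha : R) : 0 < alpha < 1 / 2 -> 2 `^ (alpha - 1 / 2) < 1 :> R.
Proof.
move=> /andP[_ al]; rewrite -[ltRHS](powRr0 (2 : R)) /powR pnatr_eq0/= ltr_expR.
by rewrite ltr_pM2r ?ln_gt0 ?ltr1n//; lra.
Qed.

Section holder_bounds.
Variables (d : nat) (nrm : 'rV[R]_d -> R) (T alpha : R).
Hypotheses (nrmP : is_norm nrm) (T0 : 0 < T) (al : 0 < alpha < 1 / 2).
Implicit Types (psi : R -> 'rV[R]_d).

Lemma holder_norm_ge_quotient psi s t : s \in `[0, T] -> t \in `[0, T] -> s != t ->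
  ((nrm (psi t - psi s) / `|t - s| `^ alpha)%:E <= holder_norm nrm T alpha psi)%E.
Proof. by move=> sT tT st; apply: ereal_sup_ubound; exists s, t. Qed.

Lemma holder_norm_ge0 psi : (0 <= holder_norm nrm T alpha psi)%E.
Proof.
apply: le_trans (@holder_norm_ge_quotient psi 0 T _ _ _); last 3 first.
- by rewrite in_itv/= lexx ltW.
- by rewrite in_itv/= lexx ltW.
- by rewrite lt_eqF.
by rewrite lee_fin divr_ge0 ?powR_ge0// is_norm_ge0.
Qed.

(** A Haar coefficient is a multiple of a difference of two adjacent increments,
    each of which is controlled by the Hoelder quotient at that scale. *)
Lemma holder_norm_ge_coef psi p j : (j < 2 ^ p)%N ->
  (((T / 2 ^+ p) `^ (1 / 2 - alpha) / 2 * nrm (haar_coef T psi (p, j.+1)))%:E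
   <= holder_norm nrm T alpha psi)%E.
Proof.
move=> jp; have [l0 mE rE rT] := dyadic_itv T0 jp.
set l := dyadic_left _ _ in l0 mE rE rT *; set m := dyadic_mid _ _ in mE rE rT *.
set r := dyadic_right _ _ in rE rT *.
set e := T / 2 ^+ p.+1 in mE rE *; set D := T / 2 ^+ p.
have e0 : 0 < e by rewrite divr_gt0 ?exprn_gt0.
have D0 : 0 < D by rewrite divr_gt0 ?exprn_gt0.
have eD : e <= D by rewrite ler_pM2l// lef_pV2 ?posrE ?exprn_gt0// ler_weXn2l// ler1n.
have quotient s t : 0 <= s -> t = s + e -> t <= T ->
    ((nrm (psi t - psi s) / e `^ alpha)%:E <= holder_norm nrm T alpha psi)%E.
  move=> s0 tE tT; have <- : `|t - s| = e by rewrite tE addrC addKr gtr0_norm.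
  by apply: holder_norm_ge_quotient; rewrite ?in_itv/=; [lra|lra|rewrite lt_eqF//; lra].
set A := nrm (psi m - psi l); set B := nrm (psi r - psi m).
have HA : ((A / e `^ alpha)%:E <= holder_norm nrm T alpha psi)%E.
  by apply: quotient => //; lra.
have HB : ((B / e `^ alpha)%:E <= holder_norm nrm T alpha psi)%E.
  by apply: quotient => //; lra.
have coef_le : nrm (haar_coef T psi (p, j.+1)) <= D `^ (- 2^-1) * (Num.max A B * 2).
  rewrite /haar_coef xpair_eqE andbF /= -/l -/m -/r.
  have [_ -> _] := nrmP; rewrite (ger0_norm (sqrtr_ge0 _)).
  rewrite haar_heightE//.
  rewrite ler_wpM2l ?powR_ge0// (le_trans (is_normB nrmP _ _))// -/A -/B.
  by rewrite mulr_natr mulr2n lerD// le_max lexx ?orbT.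
have maxAB : ((Num.max A B / e `^ alpha)%:E <= holder_norm nrm T alpha psi)%E.
  by have [] := leP A B.
apply: le_trans maxAB; rewrite lee_fin.
apply: (le_trans (ler_wpM2l _ coef_le)); first by rewrite divr_ge0 ?powR_ge0.
have AB0 : 0 <= Num.max A B by rewrite le_max is_norm_ge0.
rewrite [leLHS](_ : _ = Num.max A B * (D `^ (1 / 2 - alpha) * D `^ (- 2^-1))); last by field.
rewrite ler_wpM2l// -powRD; last by rewrite (gt_eqF D0) implybT.
rewrite (_ : _ + _ = - alpha); last by field.
rewrite powRN lef_pV2 ?posrE ?powR_gt0// ge0_ler_powR ?nnegrE ?(ltW D0) ?(ltW e0)//.
by case/andP: al => /ltW.
Qed.

Lemma sum_arith_geom_le (rho : R) n : 0 < rho < 1 ->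
  \sum_(0 <= i < n) (i.+1%:R * rho ^+ i) <= ((1 - rho) ^+ 2)^-1.
Proof.
move=> /andP[r0 r1]; have h0 : 0 < (1 - rho) ^+ 2 by rewrite exprn_gt0// subr_gt0.
rewrite -[leRHS]mul1r ler_pdivlMr//.
have -> : (\sum_(0 <= i < n) i.+1%:R * rho ^+ i) * (1 - rho) ^+ 2
   = 1 - n.+1%:R * rho ^+ n + n%:R * rho ^+ n.+1.
  elim: n => [|n IH]; first by rewrite big_nil expr0; ring.
  by rewrite big_nat_recr//= mulrDl IH !exprS -!natr1; ring.
rewrite exprS -natr1 -subr_ge0.
have := exprn_ge0 n (ltW r0); have := ler0n R n; set x := rho ^+ n; set y := n%:R.
move=> y0 x0; rewrite (_ : _ - _ = x + y * (x * (1 - rho))); last by ring.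
by rewrite addr_ge0// !mulr_ge0//; lra.
Qed.

Let rho : R := 2 `^ (alpha - 1 / 2).

Let rho01 : 0 < rho < 1. Proof. by rewrite powR_gt0//= ratio_lt1. Qed.

Lemma step_powR p : (T / 2 ^+ p) `^ (1 / 2 - alpha) = T `^ (1 / 2 - alpha) * rho ^+ p.
Proof.
rewrite powRM ?invr_ge0 ?exprn_ge0 ?ltW//; congr (_ * _).
rewrite -powR_mulrn ?powR_ge0// /rho -powRrM -[_^-1]powR_inv1 ?exprn_ge0//.
by rewrite -powR_mulrn// -!powRrM; congr (_ `^ _); ring.
Qed.

Lemma sum_sqrt_geom_le N n : (0 < N)%N ->
  \sum_(N.+1 <= p < N.+1 + n) (rho ^+ p * Num.sqrt p%:R)
  <= ((1 - rho) ^+ 2)^-1 * (2 * Num.sqrt N%:R * rho ^+ N).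
Proof.
move=> N0; have /andP[r0 r1] := rho01.
(* With p = N + 1 + i, the factor sqrt p is at most 2 * (i + 1) * sqrt N. *)
rewrite -{1}[N.+1]add0n [(N.+1 + n)%N]addnC big_addn addnK.
apply: (@le_trans _ _ (\sum_(0 <= i < n)
    (i.+1%:R * rho ^+ i) * (2 * Num.sqrt N%:R * rho ^+ N))); last first.
  rewrite -mulr_suml ler_wpM2r ?sum_arith_geom_le ?r0//.
  by rewrite !mulr_ge0 ?sqrtr_ge0// exprn_ge0// ltW.
apply: ler_sum => i _.
have sqrt_le : Num.sqrt (i + N.+1)%:R <= i.+1%:R * (2 * Num.sqrt N%:R) :> R.
  have -> : i.+1%:R * (2 * Num.sqrt N%:R) = Num.sqrt ((i.+1 * 2) ^ 2 * N)%:R :> R.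
    by rewrite natrM sqrtrM ?ler0n// natrX sqrtr_sqr ger0_norm// natrM mulrA.
  by rewrite ler_wsqrtr// ler_nat; nia.
rewrite [leRHS](_ : _ = i.+1%:R * (2 * Num.sqrt N%:R) * rho ^+ (i + N)); last first.
  by rewrite exprD; ring.
rewrite addnS exprS mulrC ler_pM ?sqrtr_ge0//.
- by rewrite mulr_ge0 ?exprn_ge0 ?ltW.
- by rewrite -addnS.
by rewrite ler_piMl ?exprn_ge0 ?ltW.
Qed.

(** An increment of level [p] is at most
    [2 * (T / 2 ^+ p) `^ (1 / 2 - alpha) * `|t - s| `^ alpha] times the largest
    coefficient of that level, so the levels beyond [N] form a geometric series
    up to the factor [Num.sqrt p].  The bound is uniform in the number of levels
    and passes to the limit. *)
Lemma holder_norm_tail_le (K U : R) psi N : (0 < N)%N ->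
  (forall i : 'I_d, nrm (delta_mx ord0 i) <= K) ->
  (forall t, t \in `[0, T] -> schauder_trunc T psi M t @[M --> \oo] --> psi t) ->
  (forall p j, (0 < p)%N -> (j < 2 ^ p)%N ->
     nrm (haar_coef T psi (p, j.+1)) <= Num.sqrt p%:R * U) ->
  (holder_norm nrm T alpha (fun t => psi t - schauder_trunc T psi N t)%R
   <= (4 * T `^ (1 / 2 - alpha) / (1 - rho) ^+ 2
       * U * Num.sqrt N%:R * rho ^+ N)%:E)%E.
Proof.
move=> N0 nrmK psi_lim coefU; have /andP[r0 r1] := rho01.
have U0 : 0 <= U.
  have := coefU 1%N 0%N isT isT; rewrite sqrtr1 mul1r; apply: le_trans.
  exact: is_norm_ge0.
have [nrmD nrmZ _] := nrmP.
apply: ge_ereal_sup => _ [s [t [sT tT st ->]]]; rewrite lee_fin.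
have ts0 : 0 < `|t - s| `^ alpha by rewrite powR_gt0// normr_gt0 subr_eq0 eq_sym.
rewrite ler_pdivrMr//.
have s0 : 0 <= s by move: sT; rewrite in_itv/= => /andP[].
have t0 : 0 <= t by move: tT; rewrite in_itv/= => /andP[].
set B := leRHS; set x := (X in nrm X).
pose y n := \sum_(N.+1 <= p < N.+1 + n) \sum_(j < 2 ^ p)
  (schauder T (p, j.+1) t - schauder T (p, j.+1) s) *: haar_coef T psi (p, j.+1).
have nrm_y n : nrm (y n) <= B.
  rewrite (le_trans (is_norm_sum nrmP _ _ _))//.
  apply: (@le_trans _ _ (\sum_(N.+1 <= p < N.+1 + n)
      (2 * T `^ (1 / 2 - alpha) * U * `|t - s| `^ alpha)
      * (rho ^+ p * Num.sqrt p%:R))); last first.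
    rewrite -mulr_sumr; apply: le_trans.
      apply: ler_wpM2l (sum_sqrt_geom_le n N0).
      by rewrite !mulr_ge0// powR_ge0.
    rewrite le_eqVlt; apply/orP; left; apply/eqP; rewrite /B.
    by field; rewrite subr_eq0 gt_eqF.
  rewrite big_nat [leRHS]big_nat; apply: ler_sum => p /andP[Np _].
  have p0 : (0 < p)%N by exact: leq_ltn_trans Np.
  rewrite (le_trans (is_norm_sum nrmP _ _ _))//.
  apply: (@le_trans _ _ (\sum_(j < 2 ^ p)
      `|schauder T (p, j.+1) t - schauder T (p, j.+1) s| * (Num.sqrt p%:R * U))).
    by apply: ler_sum => j _; rewrite nrmZ ler_wpM2l// coefU.
  rewrite -mulr_suml.
  have al1 : 0 < alpha < 1 by case/andP: al => -> ? /=; lra.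
  apply: le_trans (ler_wpM2r _ (sum_schauder_incr_le p T0 al1 s0 t0)) _.
    by rewrite mulr_ge0 ?sqrtr_ge0.
  by rewrite step_powR le_eqVlt; apply/orP; left; apply/eqP; ring.
have xy n : x - y n = (psi t - schauder_trunc T psi (N + n) t)
                      - (psi s - schauder_trunc T psi (N + n) s).
  have truncE u : schauder_trunc T psi (N + n) u - schauder_trunc T psi N u
      = \sum_(N.+1 <= p < N.+1 + n) \sum_(j < 2 ^ p)
         schauder T (p, j.+1) u *: haar_coef T psi (p, j.+1).
    rewrite !schauder_truncE [X in _ + X - _](@big_cat_nat _ _ _ N.+1)//=; last first.
      by rewrite ltnS leq_addr.
    by rewrite addrA [X in X - _]addrC addrK -addSn.
  have -> : y n = (schauder_trunc T psi (N + n) t - schauder_trunc T psi N t)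
      - (schauder_trunc T psi (N + n) s - schauder_trunc T psi N s).
    rewrite !truncE -sumrB; apply: eq_bigr => p _; rewrite -sumrB.
    by apply: eq_bigr => j _; rewrite scalerBl.
  rewrite /x; apply/rowP => i; rewrite !mxE; ring.
have K0 : 0 <= K * d%:R.
  have [d0|d0] := posnP d; first by rewrite d0 mulr0.
  by rewrite mulr_ge0// (le_trans _ (nrmK (Ordinal d0)))// is_norm_ge0.
apply/ler_addgt0Pr => e e0.
pose e' := e / (K * d%:R + 1) / 2.
have e'0 : 0 < e' by rewrite !divr_gt0// ltr_wpDl.
have near_lim u : u \in `[0, T] -> \forall M \near \oo,
    `|psi u - schauder_trunc T psi M u| < e'.
  by move=> /psi_lim /cvgrPdist_lt; apply.
have [M _ HM] := filterI (near_lim _ tT) (near_lim _ sT).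
have [Mt Ms] := HM _ (leq_addl N M).
rewrite -(subrK (y M) x) addrC (le_trans (nrmD _ _))// lerD//.
rewrite (le_trans (is_norm_le_norm nrmP _ nrmK))// xy.
apply: (@le_trans _ _ (K * d%:R * (e / (K * d%:R + 1)))).
  rewrite ler_wpM2l// [e / _]splitr; apply: (le_trans (ler_normB _ _)).
  by rewrite -/e' ltW// (ltrD Mt Ms).
rewrite mulrCA ger_pMr// ler_pdivrMr ?mul1r ?lerDl ?ltr_wpDl//.
Qed.

End holder_bounds.

End deterministic_bounds.

(** * Comparison of integrals *)

Section lower_integral.
Context d (Omega : measurableType d) (R : realType).
Variable mu : {measure set Omega -> \bar R}.
Local Open Scope ereal_scope.
Import HBNNSimple.

(** A Hoelder norm is a supremum over uncountably many pairs of times.  The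
    integral of a nonnegative function is the supremum of the integrals of the
    simple functions below it, so comparison only needs a measurable bound. *)
Lemma ge0_le_integral_nonmeasurable (f g : Omega -> \bar R) :
  (forall w, 0 <= f w) -> (forall w, f w <= g w) ->
  \int[mu]_w f w <= \int[mu]_w g w.
Proof.
move=> f0 fg; have g0 w : 0 <= g w by exact: le_trans (fg w).
rewrite !ge0_integralTE//; apply: ereal_sup_le => _ [h hf <-].
by exists h => // w; exact: le_trans (hf w) (fg w).
Qed.

Lemma ae_le_integral_nonmeasurable (f g : Omega -> \bar R) :
  (forall w, 0 <= f w) -> (forall w, 0 <= g w) -> measurable_fun [set: Omega] g ->
  {ae mu, forall w, f w <= g w} -> \int[mu]_w f w <= \int[mu]_w g w.
Proof.
move=> f0 g0 mg fg; rewrite (ge0_integralTE _ f0).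
apply: ge_ereal_sup => _ [h hf <-].
have -> : sintegral mu h = \int[mu]_w (h w)%:E.
  by rewrite integral_nnsfun// patch_setT.
apply: ae_ge0_le_integral => //.
- by move=> w _; rewrite lee_fin.
- exact/measurable_EFinP.
- by apply: filterS fg => w fgw _; exact: le_trans (hf w) fgw.
Qed.

End lower_integral.

(** * Normal laws *)

Section gaussian.
Context {R : realType}.
Local Notation leb := (@lebesgue_measure R).
Import HBNNSimple.

(** A simple function below [f] integrates against the normal law as its product
    with the density does against the Lebesgue measure. *)
Lemma integral_normal_prob_le (s : R) (f : R -> \bar R) :
  (forall x, (0 <= f x)%E) -> measurable_fun setT f ->
  (\int[normal_prob 0%R s]_x f x <= \int[leb]_x (f x * (normal_pdf 0 s x)%:E))%E.
Proof.
move=> f0 mf; rewrite ge0_integralTE//; apply: ge_ereal_sup => _ [h hf <-].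
have mpdf : measurable_fun setT (fun x => (normal_pdf 0 s x)%:E).
  by apply/measurable_EFinP; exact: measurable_normal_pdf.
have pdf0 x : (0 <= (normal_pdf 0 s x)%:E)%E by rewrite lee_fin normal_pdf_ge0.
apply: (@le_trans _ _ (\int[leb]_x ((h x)%:E * (normal_pdf 0 s x)%:E))%E); last first.
  apply: ge0_le_integral => //.
  - by move=> x _; rewrite mule_ge0// lee_fin.
  - by apply: emeasurable_funM => //; exact/measurable_EFinP.
  - by apply: emeasurable_funM.
  - by move=> x _; rewrite lee_wpmul2r.
rewrite sintegralE; under [leRHS]eq_integral.
  move=> x _; rewrite fimfunE -fsumEFin// ge0_mule_fsuml; last first.
    by move=> y; rewrite EFinM nnfun_muleindic_ge0.
  over.
rewrite ge0_integral_fsum//; last 2 first.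
- move=> y; apply: emeasurable_funM => //; apply/measurable_EFinP.
  exact: measurableT_comp.
- by move=> y x _; rewrite mule_ge0// EFinM nnfun_muleindic_ge0.
apply: lee_fsum => // y [x _ <-{y}].
rewrite /normal_prob -ge0_integralZl//; last 2 first.
- exact: measurable_funTS.
- by rewrite lee_fin.
rewrite [in leLHS]integral_mkcond le_eqVlt; apply/orP; left; apply/eqP.
apply: eq_integral => z _; rewrite patchE indicE.
by case: ifPn => _; rewrite ?mulr1// mulr0 mul0e.
Qed.

Lemma normal_peak_scaled (s : R) : 0 < s -> s * normal_peak s = (Num.sqrt (pi *+ 2))^-1.
Proof.
move=> s0; rewrite /normal_peak -mulrnAr sqrtrM ?sqr_ge0// sqrtr_sqr gtr0_norm//.
by rewrite invfM mulrA divff ?mul1r// gt_eqF.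
Qed.

(** Under a centred normal law of standard deviation [s], [exp (x^2 / (4 s^2))]
    times the density is [sqrt 2] times the density for the deviation
    [sqrt 2 * s]. *)
Lemma integral_exp_sqr_normal (s : R) : 0 < s ->
  (\int[normal_prob 0%R s]_x (expR (x ^+ 2 / (4 * s ^+ 2)))%:E <= (Num.sqrt 2)%:E)%E.
Proof.
move=> s0; have s20 : 0 < Num.sqrt 2 * s by rewrite mulr_gt0// sqrtr_gt0.
have mexp : measurable_fun setT (fun x : R => (expR (x ^+ 2 / (4 * s ^+ 2)))%:E).
  apply/measurable_EFinP; apply: measurableT_comp => //.
  by apply: measurable_funM => //; exact: measurable_funX.
apply: le_trans; first exact: integral_normal_prob_le.
rewrite (_ : (fun x => _) = (fun x => (Num.sqrt 2)%:E
   * (normal_pdf 0 (Num.sqrt 2 * s) x)%:E)%E); last first.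
  apply/funext => x; rewrite -!EFinM; congr EFin.
  rewrite !normal_pdfE ?gt_eqF// /normal_peak /normal_fun subr0.
  have -> : Num.sqrt ((Num.sqrt 2 * s) ^+ 2 * pi *+ 2)
      = Num.sqrt 2 * Num.sqrt (s ^+ 2 * pi *+ 2) :> R.
    by rewrite exprMn sqr_sqrtr// -[RHS]sqrtrM//; congr Num.sqrt; ring.
  rewrite mulrCA -expRD exprMn sqr_sqrtr// [in RHS]invfM !mulrA.
  rewrite divff ?gt_eqF ?sqrtr_gt0// mul1r.
  congr (_ * expR _); field; exact: lt0r_neq0.
by rewrite ge0_integralZl// ?integral_normal_pdf ?mule1// ?lee_fin//;
  [apply/measurable_EFinP; exact: measurable_normal_pdf
  |move=> x _; rewrite lee_fin normal_pdf_ge0].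
Qed.

(** On one interval of length [s] inside [B] the density is at least its value
    at [a * s]. *)
Lemma normal_prob_ge (s a u : R) (B : set R) : 0 < s -> measurable B ->
  (forall x, u <= x <= u + s -> B x /\ `|x| <= a * s) ->
  (((Num.sqrt (pi *+ 2))^-1 * expR (- (a ^+ 2 / 2)))%:E <= normal_prob 0 s B)%E.
Proof.
move=> s0 mB sub; have mI : measurable (`[u, u + s] : set R) by [].
have pdf0 x : (0 <= (normal_pdf 0 s x)%:E)%E by rewrite lee_fin normal_pdf_ge0.
have IB : `[u, u + s] `<=` B.
  by move=> x; rewrite /= in_itv/= => /sub[].
have mpdf : measurable_fun setT (fun x => (normal_pdf 0 s x)%:E).
  by apply/measurable_EFinP; exact: measurable_normal_pdf.
apply: (@le_trans _ _ (normal_prob 0 s `[u, u + s])); last first.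
  by apply: le_measure; rewrite ?inE.
pose c : R := normal_peak s * expR (- (a ^+ 2 / 2)).
apply: (@le_trans _ _ (\int[leb]_(x in `[u, (u + s)%R]) c%:E)%E).
  rewrite integral_cst//= lebesgue_measure_itv/= lte_fin ltrDl s0.
  by rewrite -EFinD addrAC subrr add0r -EFinM lee_fin
    -(normal_peak_scaled s0) /c (mulrC s) -!mulrA (mulrC s).
apply: ge0_le_integral => //.
- by move=> x _; rewrite lee_fin mulr_ge0 ?normal_peak_ge0 ?expR_ge0.
- exact: measurable_funTS.
- move=> x /= ; rewrite in_itv/= => /sub[_ xa].
  rewrite lee_fin normal_pdfE ?gt_eqF// ler_wpM2l ?normal_peak_ge0//.
  rewrite /normal_fun subr0 ler_expR mulNr lerN2 ler_pdivrMr ?mulrn_wgt0 ?exprn_gt0//.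
  have -> : a ^+ 2 / 2 * (s ^+ 2 *+ 2) = (a * s) ^+ 2 by rewrite exprMn; field.
  by rewrite -[leLHS]real_normK ?num_real// lerXn2r ?nnegrE ?normr_ge0// (le_trans _ xa).
Qed.

End gaussian.

(** * Independent pairs *)

Lemma prod_even_odd (V : comPzSemiRingType) (n : nat) (F : 'I_n.*2 -> V)
    (ev od : 'I_n -> 'I_n.*2) :
  (forall j, ev j = j.*2 :> nat) -> (forall j, od j = j.*2.+1 :> nat) ->
  \prod_(k < n.*2) F k = \prod_(j < n) (F (ev j) * F (od j)).
Proof.
move=> evE odE; pose G k := if insub k is Some k' then F k' else 1.
have GE (k : 'I_n.*2) : G k = F k by rewrite /G valK.
rewrite (eq_bigr (fun k : 'I_n.*2 => G k)) => [|k _]; last by rewrite GE.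
rewrite [RHS](eq_bigr (fun j : 'I_n => G j.*2 * G j.*2.+1)) => [|j _]; last first.
  by rewrite -!GE evE odE.
rewrite -(big_mkord xpredT G) -(big_mkord xpredT (fun j => G j.*2 * G j.*2.+1)).
move: G {GE} => G; elim: n {F ev od evE odE} => [|n IH]; first by rewrite !big_nil.
by rewrite doubleS !big_nat_recr//= IH mulrA.
Qed.

Section independent_pairs.
Context {R : realType} d (Omega : measurableType d) (P : probability Omega R).

Lemma measure_bigsetU_le (I : Type) (s : seq I) (F : I -> set Omega) :
  (forall i, measurable (F i)) ->
  (P (\big[setU/set0]_(i <- s) F i) <= \sum_(i <- s) P (F i))%E.
Proof.
move=> mF; elim: s => [|i s IH]; first by rewrite !big_nil measure0.
rewrite !big_cons; apply: (le_trans (measureU2 _ (mF i) _)).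
  exact: bigsetU_measurable.
by rewrite leeD2l.
Qed.

Lemma measurable_no_pair (n c : nat) (X : 'I_n.*2 * 'I_c -> Omega -> R)
    (i0 : 'I_c) (A B : set R) :
  (forall ki, measurable_fun setT (X ki)) -> measurable A -> measurable B ->
  measurable [set w | forall k l : 'I_n.*2, ~~ odd k -> l = k.+1 :> nat ->
    ~ (A (X (k, i0) w) /\ B (X (l, i0) w))].
Proof.
move=> mX mA mB.
have mpre (S : set R) ki : measurable S -> measurable (X ki @^-1` S).
  by move=> mS; rewrite -[X in measurable X]setTI; exact: mX.
rewrite (_ : mkset _ = \bigcap_(kl in [set kl : 'I_n.*2 * 'I_n.*2 |
    ~~ odd kl.1 /\ kl.2 = kl.1.+1 :> nat])
    ~` (X (kl.1, i0) @^-1` A `&` X (kl.2, i0) @^-1` B)).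
  apply: fin_bigcap_measurable => [|kl _]; first exact: finite_finset.
  by apply/measurableC/measurableI; exact: mpre.
apply/seteqP; split => w /=.
  by move=> nopair kl [ke kl1]; exact: nopair.
by move=> nopair k l ke kl1; exact: (nopair (k, l)).
Qed.

(** The complement of [A * B] is the disjoint union of [~A * setT] and [A * ~B];
    choosing one of the two alternatives in every pair covers the event by
    product events, whose probabilities add up, by distributivity, to the
    product over the pairs. *)
Lemma probability_no_pair_le (n c : nat) (X : 'I_n.*2 * 'I_c -> Omega -> R)
    (i0 : 'I_c) (A B : set R) (a b : R) :
  mutually_independent P X -> (forall ki, measurable_fun setT (X ki)) ->
  measurable A -> measurable B -> 0 <= a -> 0 <= b ->
  (forall k, (a%:E <= P (X (k, i0) @^-1` A))%E) ->
  (forall k, (b%:E <= P (X (k, i0) @^-1` B))%E) ->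
  (P [set w | forall k l : 'I_n.*2, ~~ odd k -> l = k.+1 :> nat ->
        ~ (A (X (k, i0) w) /\ B (X (l, i0) w))]
   <= ((1 - a * b) ^+ n)%:E)%E.
Proof.
move=> indep mX mA mB a0 b0 aA bB.
have evP (j : 'I_n) : (j.*2 < n.*2)%N by rewrite ltn_double.
have odP (j : 'I_n) : (j.*2.+1 < n.*2)%N by rewrite ltn_Sdouble.
have haP (k : 'I_n.*2) : (k./2 < n)%N by rewrite ltn_half_double.
pose ev j := Ordinal (evP j); pose od j := Ordinal (odP j).
pose half k := Ordinal (haP k).
have halfev j : half (ev j) = j by apply/val_inj; rewrite /= doubleK.
have halfod j : half (od j) = j by apply/val_inj; rewrite /= uphalf_double.
pose Q (f : {ffun 'I_n -> bool}) (k : 'I_n.*2) : set R :=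
  if odd k then (if f (half k) then ~` B else setT)
  else (if f (half k) then A else ~` A).
pose Q' f (ki : 'I_n.*2 * 'I_c) : set R := if ki.2 == i0 then Q f ki.1 else setT.
have mQ f k : measurable (Q f k).
  by rewrite /Q; case: ifP => _; case: ifP => _ //; exact: measurableC.
have mQ' f ki : measurable (Q' f ki) by rewrite /Q'; case: ifP.
have mpre (S : set R) ki : measurable S -> measurable (X ki @^-1` S).
  by move=> mS; rewrite -[X in measurable X]setTI; exact: mX.
pose F f := [set w | forall ki, Q' f ki (X ki w)].
have mF f : measurable (F f).
  rewrite (_ : F f = \bigcap_(ki in setT) (X ki @^-1` (Q' f ki))).
    by apply: fin_bigcap_measurable => [|ki _]; [exact: finite_finset|exact: mpre].
  by apply/seteqP; split => w Fw ki; [move=> _; exact: Fw|exact: (Fw ki I)].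
pose pr (S : set R) k := fine (P (X (k, i0) @^-1` S)).
have prE (S : set R) k : measurable S -> P (X (k, i0) @^-1` S) = (pr S k)%:E.
  by move=> mS; rewrite fineK// fin_num_measure//; exact: mpre.
have PF f : P (F f) = (\prod_(j < n) (pr (Q f (ev j)) (ev j) * pr (Q f (od j)) (od j)))%:E.
  rewrite (indep (Q' f) (mQ' f)).
  rewrite -(@prod_even_odd _ _ (fun k => pr (Q f k) k) ev od)// -prodEFin.
  rewrite (eq_bigr (fun ki : 'I_n.*2 * 'I_c => P (X (ki.1, ki.2) @^-1` Q' f (ki.1, ki.2))));
    last by case.
  rewrite -(pair_bigA _ (fun k i => P (X (k, i) @^-1` Q' f (k, i))))/=.
  apply: eq_bigr => k _; rewrite (bigD1 i0)//= big1 ?mule1.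
    by rewrite /Q' /= eqxx prE.
  by move=> i ii0; rewrite /Q' /= (negbTE ii0) preimage_setT probability_setT.
apply: (@le_trans _ _ (P (\big[setU/set0]_(f : {ffun 'I_n -> bool}) F f))).
  apply: le_measure; rewrite ?inE.
  - exact: (measurable_no_pair i0 mX mA mB).
  - exact: bigsetU_measurable.
  move=> w /= nopair; rewrite -bigcup_seq.
  pose f := [ffun j => `[< A (X (ev j, i0) w) >]].
  exists f; first by rewrite /= mem_index_enum.
  move=> [k i]; rewrite /Q' /=; case: eqP => // ->; rewrite /Q ffunE.
  case: ifPn => ko; last first.
    have -> : ev (half k) = k.
      by apply/val_inj => /=; rewrite -[RHS]odd_double_half (negbTE ko).
    by case: asboolP.
  case: asboolP => // Ak Bk.
  apply: (nopair (ev (half k)) k _ _ (conj Ak Bk)); first by rewrite /= odd_double.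
  by rewrite /= -[LHS]odd_double_half ko.
apply: (le_trans (measure_bigsetU_le _ mF)).
under eq_bigr do rewrite PF.
rewrite sumEFin lee_fin.
pose G (j : 'I_n) (u : bool) : R :=
  (if u then pr A (ev j) else pr (~` A) (ev j)) *
  (if u then pr (~` B) (od j) else 1).
rewrite (eq_bigr (fun f : {ffun 'I_n -> bool} => \prod_(j < n) G j (f j))); last first.
  move=> f _; apply: eq_bigr => j _; rewrite /G /Q /= odd_double/= halfev halfod.
  by case: (f j); rewrite // /pr preimage_setT probability_setT.
rewrite -(bigA_distr_bigA G).
have prC (S : set R) k : measurable S -> pr (~` S) k = 1 - pr S k.
  move=> mS; rewrite /pr preimage_setC probability_setC; last exact: mpre.
  by rewrite prE.
have pr01 (S : set R) k : measurable S -> 0 <= pr S k <= 1.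
  move=> mS; rewrite -!lee_fin -prE// measure_ge0 probability_le1//.
  exact: mpre.
rewrite -[n in leRHS]card_ord -prodr_const; apply: ler_prod => j _.
rewrite big_bool /G /= !prC// mulr1.
have := aA (ev j); rewrite prE// lee_fin => aj.
have := bB (od j); rewrite prE// lee_fin => bj.
have /andP[A0 A1] := pr01 A (ev j) mA; have /andP[B0 B1] := pr01 B (od j) mB.
apply/andP; split; first by rewrite addr_ge0 ?mulr_ge0 ?subr_ge0.
by have := ler_pM a0 b0 aj bj; nra.
Qed.

End independent_pairs.

(** * Inequalities for powers *)

Section powers.
Context {R : realType}.

(** This is [y <= expR y] at [y = x ^+ 2 / (4 * r)], raised to the power
    [r / 2]. *)
Lemma powR_le_exp_sqr (r x : R) : 0 < r -> 0 <= x ->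
  x `^ r <= (4 * r) `^ (r / 2) * expR (x ^+ 2 / 8).
Proof.
move=> r0 x0; have r40 : 0 < 4 * r by rewrite mulr_gt0.
have -> : x ^+ 2 / 8 = (x ^+ 2 / (4 * r)) * (r / 2) by field; exact: lt0r_neq0.
have -> : x `^ r = (4 * r) `^ (r / 2) * (x ^+ 2 / (4 * r)) `^ (r / 2).
  rewrite -powRM ?(ltW r40)// ?divr_ge0 ?sqr_ge0 ?(ltW r40)//.
  by rewrite mulrCA divff ?mulr1 ?gt_eqF// -powR_mulrn// -powRrM; congr (_ `^ _); field.
rewrite ler_wpM2l ?powR_ge0// expRM ge0_ler_powR ?nnegrE ?expR_ge0//.
- by rewrite divr_ge0// ltW.
- by rewrite divr_ge0 ?sqr_ge0// ltW.
- by apply: le_trans (expR_ge1Dx _); rewrite lerDr.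
Qed.

(** Below the threshold [4 * sqrt p] the left side is at most [4 `^ r]; above it
    half of the Gaussian exponential absorbs the power and the other half is
    at least [4 ^+ p], enough to beat the number of intervals at level [p]. *)
Lemma powR_div_sqrt_le (r x : R) (p : nat) : 0 < r -> 0 <= x -> (0 < p)%N ->
  (x / Num.sqrt p%:R) `^ r
  <= 4 `^ r + (4 * r) `^ (r / 2) / 4 ^+ p * expR (x ^+ 2 / 4).
Proof.
move=> r0 x0 p0; have sp : 0 < Num.sqrt p%:R :> R by rewrite sqrtr_gt0 ltr0n.
have sp1 : 1 <= Num.sqrt p%:R :> R by rewrite -{1}(@sqrtr1 R) ler_wsqrtr// ler1n.
have x_sp : 0 <= x / Num.sqrt p%:R by rewrite divr_ge0// ltW.
have [xle|xgt] := leP x (4 * Num.sqrt p%:R).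
  apply: (@le_trans _ _ (4 `^ r)).
    by rewrite ge0_ler_powR ?nnegrE ?(ltW r0)// ler_pdivrMr.
  by rewrite lerDl mulr_ge0 ?expR_ge0// divr_ge0 ?powR_ge0// exprn_ge0.
apply: (@le_trans _ _ (x `^ r)).
  rewrite ge0_ler_powR ?nnegrE ?(ltW r0)// ler_pdivrMr//.
  by rewrite ler_peMr.
apply: le_trans (powR_le_exp_sqr r0 x0) _.
apply: (@le_trans _ _ ((4 * r) `^ (r / 2) / 4 ^+ p * expR (x ^+ 2 / 4))); last first.
  by rewrite lerDr powR_ge0.
rewrite -mulrA ler_wpM2l ?powR_ge0// ler_pdivlMl ?exprn_gt0//.
have -> : x ^+ 2 / 4 = x ^+ 2 / 8 + x ^+ 2 / 8 by field.
rewrite expRD ler_wpM2r ?expR_ge0//.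
have p2 : p%:R * 2 <= x ^+ 2 / 8.
  rewrite ler_pdivlMr//; have := ltW xgt; rewrite -ler_sqr ?nnegrE ?mulr_ge0 ?(ltW sp)//.
  by rewrite exprMn sqr_sqrtr//; lra.
apply: (@le_trans _ _ (expR (p%:R * 2))); last by rewrite ler_expR.
rewrite mulrC expRM powR_mulrn ?expR_ge0// lerXn2r ?nnegrE ?expR_ge0//.
rewrite (_ : 2 = 1 * 2%:R); last by rewrite mul1r.
rewrite expRM powR_mulrn ?expR_ge0//.
have : 2 <= expR 1 :> R by exact: le_trans (expR_ge1Dx 1).
by nra.
Qed.

(** The power-mean inequality, from Young's inequality for each term against the
    mean [m]. *)
Lemma powR_sum_le (r : R) (d : nat) (x : 'I_d -> R) : 1 < r -> (0 < d)%N ->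
  (forall i, 0 <= x i) ->
  (\sum_i x i) `^ r <= d%:R `^ (r - 1) * \sum_i x i `^ r.
Proof.
move=> r1 d0 x0; have r0 : 0 < r by rewrite (lt_trans _ r1).
have d0' : 0 < d%:R :> R by rewrite ltr0n.
set S := \sum_i x i; set A := \sum_i _.
have S0 : 0 <= S by exact: sumr_ge0.
pose m := S / d%:R; have m0 : 0 <= m by rewrite divr_ge0 ?(ltW d0').
have SE : S = d%:R * m by rewrite /m mulrCA divff ?mulr1// gt_eqF.
pose q := r / (r - 1); have q0 : 0 < q by rewrite divr_gt0 ?subr_gt0.
have rq : r^-1 + q^-1 = 1.
  by rewrite /q invf_div; field; exact: lt0r_neq0.
have young i : x i * m `^ (r - 1) <= x i `^ r / r + m `^ r / q.
  have := conjugate_powR (x0 i) (powR_ge0 m (r - 1)) r0 q0 rq.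
  by rewrite -[in X in _ <= _ + X]powRrM (_ : (r - 1) * q = r)// /q; field; rewrite subr_eq0 gt_eqF.
have : \sum_i x i * m `^ (r - 1) <= \sum_i (x i `^ r / r + m `^ r / q).
  by apply: ler_sum => i _; exact: young.
rewrite -mulr_suml -/S big_split/= -mulr_suml -/A sumr_const card_ord.
rewrite SE -mulrA mulr_powRB1// -[(m `^ r / q) *+ d]mulr_natl.
have -> : q^-1 = 1 - r^-1 by rewrite -rq addrAC subrr add0r.
move=> H; have {}H : d%:R * m `^ r / r <= A / r by move: H; lra.
have dmA : d%:R * m `^ r <= A by rewrite -(ler_pM2r (_ : 0 < r^-1)) ?invr_gt0.
rewrite powRM ?(ltW d0')// -(mulr_powRB1 (ltW d0') r0) [X in X * _]mulrC -mulrA.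
by rewrite ler_wpM2l ?powR_ge0.
Qed.

End powers.

(** * Increments of a Brownian path *)

Section brownian_increments.
Context {R : realType} disp (Omega : measurableType disp) (P : probability Omega R).
Variables (c : nat) (T : R) (W : R -> Omega -> 'rV[R]_c).
Hypotheses (T0 : 0 < T) (bm : is_brownian_motion P T W).

Definition grid_incr (q k : nat) (i : 'I_c) (w : Omega) : R :=
  W (k.+1%:R * (T / 2 ^+ q)) w ord0 i - W (k%:R * (T / 2 ^+ q)) w ord0 i.

Let step_gt0 q : 0 < T / 2 ^+ q. Proof. by rewrite divr_gt0 ?exprn_gt0. Qed.

Let grid_in q k : (k <= 2 ^ q)%N -> k%:R * (T / 2 ^+ q) \in `[0, T].
Proof.
move=> kq; rewrite in_itv/= mulr_ge0 ?(ltW (step_gt0 _))//=.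
by rewrite mulrA ler_pdivrMr ?exprn_gt0// mulrC ler_wpM2l ?(ltW T0)// -natrX ler_nat.
Qed.

Lemma measurable_grid_incr q k i : (k < 2 ^ q)%N -> measurable_fun setT (grid_incr q k i).
Proof.
by move=> kq; apply: measurable_funB; apply: (bm_meas bm); apply: grid_in => //; exact: ltnW.
Qed.

Lemma grid_incr_law q k i (B : set R) : (k < 2 ^ q)%N -> measurable B ->
  P (grid_incr q k i @^-1` B) = normal_prob 0 (Num.sqrt (T / 2 ^+ q)) B.
Proof.
move=> kq mB.
have /andP[t0 _] : 0 <= k%:R * (T / 2 ^+ q) <= T.
  by have := grid_in (ltnW kq); rewrite in_itv.
have /andP[_ tT] : 0 <= k.+1%:R * (T / 2 ^+ q) <= T.
  by have := grid_in kq; rewrite in_itv.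
have lt_t : k%:R * (T / 2 ^+ q) < k.+1%:R * (T / 2 ^+ q).
  by rewrite ltr_pM2r// ltr_nat.
rewrite [LHS](bm_gauss bm i t0 lt_t tT mB); congr (normal_prob 0 (Num.sqrt _) B).
by rewrite -mulrBl -natrB// subSnn mul1r.
Qed.

Lemma grid_incr_indep q :
  mutually_independent P (fun ki : 'I_(2 ^ q) * 'I_c => grid_incr q ki.1 ki.2).
Proof.
apply: (bm_indep bm (t := fun k => k%:R * (T / 2 ^+ q))).
- by rewrite mul0r.
- by have := grid_in (leqnn (2 ^ q)); rewrite in_itv => /andP[].
- by move=> k _; rewrite ltr_pM2r// ltr_nat.
Qed.

Lemma haar_coef_grid_incr p j w i :
  haar_coef T (fun t => W t w) (p, j.+1) ord0 i
  = Num.sqrt (2 ^+ p / T)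
    * (grid_incr p.+1 j.*2 i w - grid_incr p.+1 j.*2.+1 i w).
Proof.
rewrite /haar_coef xpair_eqE andbF /= !mxE /grid_incr.
have e0 : 2 ^+ p != 0 :> R by rewrite expf_neq0.
have -> : dyadic_left T (p, j.+1) = j.*2%:R * (T / 2 ^+ p.+1).
  by rewrite dyadic_leftE -muln2 natrM exprS; field.
have -> : dyadic_mid T (p, j.+1) = j.*2.+1%:R * (T / 2 ^+ p.+1).
  by rewrite dyadic_midE -[j.*2.+1%:R]natr1 -muln2 natrM exprS; field.
have -> // : dyadic_right T (p, j.+1) = j.*2.+2%:R * (T / 2 ^+ p.+1).
by rewrite dyadic_rightE -[j.*2.+2%:R]natr1 -[j.*2.+1%:R]natr1 -muln2 natrM exprS; field.
Qed.

Lemma integral_exp_sqr_incr q k i : (k < 2 ^ q)%N ->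
  (\int[P]_w (expR (grid_incr q k i w ^+ 2 / (4 * (T / 2 ^+ q))))%:E
   <= (Num.sqrt 2)%:E)%E.
Proof.
move=> kq; set s := Num.sqrt (T / 2 ^+ q).
have s0 : 0 < s by rewrite sqrtr_gt0.
have s2 : s ^+ 2 = T / 2 ^+ q by rewrite sqr_sqrtr// ltW.
pose f (x : R) := (expR (x ^+ 2 / (4 * s ^+ 2)))%:E.
have mf : measurable_fun setT f.
  apply/measurable_EFinP; apply: measurableT_comp => //.
  by apply: measurable_funM => //; exact: measurable_funX.
have mX := measurable_grid_incr i kq.
rewrite (_ : (fun w => _) = f \o grid_incr q k i); last first.
  by apply/funext => w; rewrite /f /= s2.
rewrite -[setT](preimage_setT (grid_incr q k i)).
have mX' : @measurable_fun _ _ Omega (measurableTypeR R) setT (grid_incr q k i) by exact: mX.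
have mf' : @measurable_fun _ _ (measurableTypeR R) (\bar R) setT f by exact: mf.
rewrite -(ge0_integral_pushforward mX' P measurableT mf'); last first.
  by move=> x _; rewrite lee_fin expR_ge0.
apply: le_trans (integral_exp_sqr_normal s0).
rewrite le_eqVlt; apply/orP; left; apply/eqP.
apply: (eq_measure_integral (normal_prob 0 s)) => B mB _.
exact: grid_incr_law.
Qed.

(** A single integrable random variable controlling every normalized increment:
    for all [p > 0] at once, its [r]-th root times [sqrt p] bounds the increments
    over the cells of mesh [T / 2 ^+ p.+1], divided by their standard deviation. *)
Definition sup_incr_bound (r : R) (i : 'I_c) (w : Omega) : \bar R :=
  ((4 `^ r)%:E + \sum_(0 <= p <oo) (\sum_(k < 2 ^ p.+1)
    (4 * r) `^ (r / 2) / 4 ^+ p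
    * expR (grid_incr p.+1 k i w ^+ 2 / (4 * (T / 2 ^+ p.+1))))%:E)%E.

Let level_term r p (i : 'I_c) w : R := \sum_(k < 2 ^ p.+1)
    (4 * r) `^ (r / 2) / 4 ^+ p
    * expR (grid_incr p.+1 k i w ^+ 2 / (4 * (T / 2 ^+ p.+1))).

Let level_term_ge0 r p i w : 0 <= level_term r p i w.
Proof.
apply: sumr_ge0 => k _.
by rewrite mulr_ge0 ?expR_ge0// divr_ge0 ?powR_ge0// exprn_ge0.
Qed.

Let measurable_level_term r p i : measurable_fun setT (level_term r p i).
Proof.
apply: measurable_sum => k; apply: measurable_funM => //.
apply: measurableT_comp => //; apply: measurable_funM => //.
by apply: measurable_funX; exact: measurable_grid_incr.
Qed.

Lemma sup_incr_bound_ge0 r i w : (0 <= sup_incr_bound r i w)%E.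
Proof.
rewrite adde_ge0 ?lee_fin ?powR_ge0//.
by apply: nneseries_ge0 => p _ _; rewrite lee_fin level_term_ge0.
Qed.

Lemma measurable_sup_incr_bound r i : measurable_fun setT (sup_incr_bound r i).
Proof.
apply: emeasurable_funD => //; apply: ge0_emeasurable_sum => [p w _ _|p _].
  by rewrite lee_fin level_term_ge0.
by apply/measurable_EFinP; exact: measurable_level_term.
Qed.

Lemma integral_sup_incr_bound_le r i :
  (\int[P]_w sup_incr_bound r i w
   <= (4 `^ r + 4 * Num.sqrt 2 * (4 * r) `^ (r / 2))%:E)%E.
Proof.
have mlev p : measurable_fun setT (EFin \o level_term r p i).
  by apply/measurable_EFinP; exact: measurable_level_term.
rewrite ge0_integralD//; last 2 first.
- by move=> w _; apply: nneseries_ge0 => p _ _; rewrite lee_fin level_term_ge0.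
- apply: ge0_emeasurable_sum => [p w _ _|p _]; last exact: mlev.
  by rewrite lee_fin level_term_ge0.
rewrite integral_cst//= probability_setT mule1 EFinD leeD2l//.
rewrite integral_nneseries//; last first.
  by move=> p w _; rewrite lee_fin level_term_ge0.
set C := (4 * r) `^ (r / 2).
have C0 : 0 <= 4 * Num.sqrt 2 * C by rewrite !mulr_ge0 ?sqrtr_ge0 ?powR_ge0.
apply: le_trans (epsilon_trick0 xpredT C0).
apply: lee_nneseries => p *.
  by apply: integral_ge0 => w _; rewrite lee_fin level_term_ge0.
have Cp0 : 0 <= C / 4 ^+ p by rewrite divr_ge0 ?powR_ge0// exprn_ge0.
under eq_integral do rewrite -sumEFin.
have mterm (k : 'I_(2 ^ p.+1)) : measurable_fun setT (fun w =>
    (expR (grid_incr p.+1 k i w ^+ 2 / (4 * (T / 2 ^+ p.+1))))%:E).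
  apply/measurable_EFinP; apply: measurableT_comp => //.
  by apply: measurable_funM => //; apply: measurable_funX; exact: measurable_grid_incr.
rewrite ge0_integral_sum//; last 2 first.
- by move=> k; under eq_fun do rewrite EFinM; apply: measurable_funeM.
- by move=> k w _; rewrite lee_fin mulr_ge0 ?expR_ge0.
apply: (@le_trans _ _ (\sum_(k < 2 ^ p.+1) (C / 4 ^+ p * Num.sqrt 2)%:E)%E).
  apply: lee_sum => k _; under eq_integral do rewrite EFinM.
  rewrite ge0_integralZl ?lee_fin//.
  by rewrite [leRHS]EFinM lee_wpmul2l ?lee_fin// integral_exp_sqr_incr.
rewrite sumEFin lee_fin sumr_const card_ord -[leLHS]mulr_natl.
rewrite le_eqVlt; apply/orP; left; apply/eqP.
rewrite !natrX !exprS (_ : 4 ^+ p = 2 ^+ p * 2 ^+ p); last by rewrite -exprMn; congr (_ ^+ _); ring.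
by field; rewrite expf_neq0.
Qed.

Lemma le_sup_incr_bound r p k i w : 0 < r -> (0 < p)%N -> (k < 2 ^ p.+1)%N ->
  (((`|grid_incr p.+1 k i w| / Num.sqrt (T / 2 ^+ p.+1) / Num.sqrt p%:R) `^ r)%:E
   <= sup_incr_bound r i w)%E.
Proof.
move=> r0 p0 kp; have sq0 : 0 < Num.sqrt (T / 2 ^+ p.+1) by rewrite sqrtr_gt0.
apply: (@le_trans _ _ (4 `^ r + level_term r p i w)%:E).
  rewrite lee_fin; apply: le_trans (powR_div_sqrt_le r0 _ p0) _.
    by rewrite divr_ge0 ?sqrtr_ge0.
  rewrite lerD2l /level_term (bigD1 (Ordinal kp))//= exprMn real_normK ?num_real// exprVn.
  rewrite sqr_sqrtr ?(ltW (step_gt0 _))// -[X in expR X]mulrA -invfM [_ * 4]mulrC.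
  rewrite lerDl sumr_ge0// => l _.
  by rewrite mulr_ge0 ?expR_ge0// divr_ge0 ?powR_ge0// exprn_ge0.
rewrite EFinD leeD2l//.
apply: le_trans (nneseries_lim_ge p.+1 _); last first.
  by move=> q _ _; rewrite lee_fin level_term_ge0.
rewrite big_nat_recr//= leeDr// sume_ge0// => q _.
by rewrite lee_fin level_term_ge0.
Qed.

End brownian_increments.

(** * Large coefficients *)

Section large_coefficients.
Context {R : realType}.

Lemma one_sub_pow_le (n : nat) (y q : R) : 0 <= y <= 1 -> 0 <= q <= n%:R * y ->
  (1 - y) ^+ n <= (1 + q)^-1.
Proof.
move=> /andP[y0 y1] /andP[q0 qn].
apply: (@le_trans _ _ (expR (- y) ^+ n)).
  by rewrite lerXn2r ?nnegrE ?expR_ge0 ?subr_ge0//; exact: expR_ge1Dx.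
rewrite -expRM_natr mulNr expRN lef_pV2 ?posrE ?expR_gt0//; last first.
  by rewrite ltr_wpDr.
by rewrite mulrC; apply: le_trans (expR_ge1Dx _); rewrite lerD2l.
Qed.

(** The standard normal density at the origin. *)
Definition gauss_const : R := (Num.sqrt (pi *+ 2))^-1.

Lemma gauss_const_gt0 : 0 < gauss_const.
Proof. by rewrite invr_gt0 sqrtr_gt0 mulrn_wgt0// pi_gt0. Qed.

(** A lower bound, uniform in the level, for the expected number of large
    coefficients of one level. *)
Definition hit_const : R := gauss_const ^+ 2 * expR (- (3 / 2)).

Lemma hit_const_gt0 : 0 < hit_const.
Proof. by rewrite mulr_gt0 ?expR_gt0// exprn_gt0// gauss_const_gt0. Qed.

(** The tail at [sqrt N / 2] standard deviations is at least of order
    [exp (- N / 4)], and there are [2 ^ N.+1] independent trials. *)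
Lemma hit_const_le (N : nat) (x : R) : x = Num.sqrt N%:R / 2 ->
  hit_const <= (2 ^ N.+1)%:R *
    ((gauss_const * expR (- ((x + 1) ^+ 2 / 2)))
     * (gauss_const * expR (- (1 ^+ 2 / 2)))).
Proof.
move=> xE; have x2 : x ^+ 2 = N%:R / 4.
  by rewrite xE expr_div_n sqr_sqrtr// -natrX.
have -> : (2 ^ N.+1)%:R *
    ((gauss_const * expR (- ((x + 1) ^+ 2 / 2)))
     * (gauss_const * expR (- (1 ^+ 2 / 2))))
   = gauss_const ^+ 2 * ((2 ^ N.+1)%:R * expR (- ((x + 1) ^+ 2 / 2) - 1 ^+ 2 / 2)).
  by rewrite expRD; ring.
rewrite ler_wpM2l ?sqr_ge0//.
apply: (@le_trans _ _ ((2 ^ N.+1)%:R * expR (- (N%:R / 4) - 3 / 2))); last first.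
  rewrite ler_wpM2l// ler_expR; have := sqr_ge0 (x - 1).
  by rewrite -x2 expr1n !expr2; lra.
rewrite expRD mulrA ler_peMl ?expR_ge0// expnS natrM natrX -mulNr mulrC.
have -> : - N%:R / 4 = - (4^-1) * N%:R :> R by ring.
rewrite expRM_natr mulrCA -exprMn.
have : 1 <= expR (- 4^-1) * 2 :> R by have := expR_ge1Dx (- 4^-1 : R); lra.
by move=> /(exprn_ege1 N); lra.
Qed.

Context disp (Omega : measurableType disp) (P : probability Omega R).
Variables (c : nat) (T : R) (W : R -> Omega -> 'rV[R]_c).
Hypotheses (T0 : 0 < T) (bm : is_brownian_motion P T W).

Lemma haar_height_step (p : nat) :
  Num.sqrt (2 ^+ p / T) * Num.sqrt (T / 2 ^+ p.+1) = Num.sqrt (2^-1) :> R.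
Proof.
rewrite -sqrtrM ?divr_ge0 ?exprn_ge0 ?(ltW T0)//; congr Num.sqrt.
by rewrite exprS; field; rewrite expf_neq0 ?(lt0r_neq0 T0).
Qed.

(** In the coefficient [(N.+1, j.+1)] the increment over the left half is asked
    to be at least [sqrt N / 2] standard deviations and the one over the right
    half to be nonpositive; these product events are independent in [j]. *)
Lemma probability_large_coef (N : nat) (i : 'I_c) : exists E : set Omega,
  [/\ measurable E, ((1 - (1 + hit_const)^-1)%:E <= P E)%E
    & forall w, E w -> exists2 j, (j < 2 ^ N.+1)%N &
        Num.sqrt N%:R / 4 <= haar_coef T (fun t => W t w) (N.+1, j.+1) ord0 i].
Proof.
pose n := (2 ^ N.+1)%N; pose q := N.+2; pose s : R := Num.sqrt (T / 2 ^+ q).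
have s0 : 0 < s by rewrite sqrtr_gt0 divr_gt0 ?exprn_gt0.
have nq : n.*2 = (2 ^ q)%N by rewrite /n /q [in RHS]expnS mul2n.
pose x : R := Num.sqrt N%:R / 2; have x0 : 0 <= x by rewrite divr_ge0 ?sqrtr_ge0.
pose X (ki : 'I_n.*2 * 'I_c) := grid_incr T W q ki.1 ki.2.
have Xindep : mutually_independent P X.
  by have := @grid_incr_indep _ _ _ _ _ _ _ T0 bm q; rewrite /X -nq.
have kq (k : 'I_n.*2) : (k < 2 ^ q)%N by rewrite -nq.
have mX ki : measurable_fun setT (X ki) by exact: (measurable_grid_incr T0 bm ki.2 (kq ki.1)).
pose A : set R := [set` `[x * s, +oo[]; pose B : set R := [set` `]-oo, 0]].
pose a := gauss_const * expR (- ((x + 1) ^+ 2 / 2)).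
pose b := gauss_const * expR (- (1 ^+ 2 / 2)).
have a0 : 0 <= a by rewrite mulr_ge0 ?expR_ge0// ltW// gauss_const_gt0.
have b0 : 0 <= b by rewrite mulr_ge0 ?expR_ge0// ltW// gauss_const_gt0.
have mA : measurable A by exact: measurable_itv.
have mB : measurable B by exact: measurable_itv.
have aA k : (a%:E <= P (X (k, i) @^-1` A))%E.
  rewrite /X /= (grid_incr_law T0 bm)//; apply: (@normal_prob_ge _ _ _ (x * s)) => //.
  have xs : 0 <= x * s by rewrite mulr_ge0// ltW.
  move=> y /andP[xy yx]; split; first by rewrite /A /= in_itv/= xy.
  by rewrite ger0_norm ?mulrDl ?mul1r// (le_trans xs).
have bB k : (b%:E <= P (X (k, i) @^-1` B))%E.
  rewrite /X /= (grid_incr_law T0 bm)//; apply: (@normal_prob_ge _ _ _ (- s)) => //.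
  move=> y; rewrite addNr => /andP[sy y0]; split; first by rewrite /B /= in_itv/=.
  by rewrite mul1r ler0_norm// lerNl.
have le1 (u : R) (S : set Omega) : (u%:E <= P S)%E -> measurable S -> u <= 1.
  by move=> uS mS; rewrite -lee_fin (le_trans uS)// probability_le1.
have mpre (S : set R) ki : measurable S -> measurable (X ki @^-1` S).
  by move=> mS; rewrite -[X in measurable X]setTI; exact: mX.
have n0 : (0 < n.*2)%N by rewrite double_gt0 expn_gt0.
have a1 : a <= 1 by apply: le1 (aA (Ordinal n0)) _; exact: mpre.
have b1 : b <= 1 by apply: le1 (bB (Ordinal n0)) _; exact: mpre.
set NP := [set w | forall k l : 'I_n.*2, ~~ odd k -> l = k.+1 :> nat ->
        ~ (A (X (k, i) w) /\ B (X (l, i) w))].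
have mNP : measurable NP by exact: measurable_no_pair.
have PNP : (P NP <= ((1 + hit_const)^-1)%:E)%E.
  apply: le_trans (probability_no_pair_le Xindep mX mA mB a0 b0 aA bB) _.
  rewrite lee_fin; apply: one_sub_pow_le; first by rewrite mulr_ge0//= mulr_ile1.
  by rewrite (ltW hit_const_gt0)/= hit_const_le.
exists (~` NP); split; first exact: measurableC.
  by rewrite probability_setC// EFinB leeB.
move=> w /existsNP[k /existsNP[l /not_implyP[ke /not_implyP[kl /contrapT [Ak Bl]]]]].
have kE : k = k./2.*2 :> nat by rewrite -[LHS]odd_double_half (negbTE ke).
exists k./2; first by rewrite -ltn_double -kE ltn_ord.
rewrite haar_coef_grid_incr -kE; move: Ak Bl.
rewrite /A /B /= !in_itv/= andbT /X /= kl => Ak Bl.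
apply: (@le_trans _ _ (Num.sqrt (2 ^+ N.+1 / T) * (x * s))); last first.
  by rewrite ler_wpM2l ?sqrtr_ge0//; lra.
rewrite mulrCA haar_height_step /x.
have : 2^-1 <= Num.sqrt (2^-1) :> R.
  by rewrite -[leLHS]ger0_norm// -sqrtr_sqr ler_wsqrtr// expr2; lra.
by have := sqrtr_ge0 (N%:R : R); nra.
Qed.

End large_coefficients.

(** * Moments of the Hoelder norm of the tail *)

Section moment_bounds.
Context {R : realType}.

Lemma lee_poweR (r : R) (x y : \bar R) : 0 <= r -> (0 <= x)%E -> (x <= y)%E ->
  (x `^ r <= y `^ r)%E.
Proof.
move=> r0 x0 xy; apply: gt0_ler_poweR => //.
  by rewrite in_itv/= x0 leey.
by rewrite in_itv/= (le_trans x0 xy) leey.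
Qed.

Lemma powRK (r x : R) : 0 < r -> 0 <= x -> (x `^ r) `^ r^-1 = x.
Proof. by move=> r0 x0; rewrite -powRrM divff ?powRr1// gt_eqF. Qed.

Context disp (Omega : measurableType disp) (P : probability Omega R).
Variables (d : nat) (nrm : 'rV[R]_d -> R) (T alpha r : R).
Hypotheses (nrmP : is_norm nrm) (T0 : 0 < T) (al : 0 < alpha < 1 / 2) (r1 : 1 < r).
Variable (W : R -> Omega -> 'rV[R]_d).
Hypothesis (bm : is_brownian_motion P T W).

Let rho : R := 2 `^ (alpha - 1 / 2).

Let r0 : 0 < r. Proof. exact: lt_trans r1. Qed.

Let tail_norm (N : nat) (w : Omega) : \bar R := holder_norm nrm T alpha
  (fun t => W t w - schauder_trunc T (fun s => W s w) N t).

Let tail_norm_ge0 N w : (0 <= tail_norm N w)%E.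
Proof. exact: holder_norm_ge0. Qed.

(** On an event of probability bounded below some coefficient of level [N.+1] is
    at least [sqrt N / 4], and the Hoelder norm dominates every coefficient. *)
Lemma moment_lower_bound (c0 : R) (i : 'I_d) (N : nat) : 0 < c0 ->
  (forall u : 'rV[R]_d, c0 * `|u ord0 i| <= nrm u) ->
  ((T `^ (1 / 2 - alpha) * rho ^+ N.+1 / 2 * (c0 * (Num.sqrt N%:R / 4))
     * (1 - (1 + hit_const)^-1) `^ r^-1)%:E
   <= (\int[P]_w (tail_norm N w) `^ r) `^ r^-1)%E.
Proof.
move=> c00 nrm_c0; have [E [mE PE largeE]] := probability_large_coef T0 bm N i.
set b := T `^ (1 / 2 - alpha) * rho ^+ N.+1 / 2 * (c0 * (Num.sqrt N%:R / 4)).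
set p0 := 1 - (1 + hit_const)^-1 in PE *.
have Ts0 : 0 <= T `^ (1 / 2 - alpha) * rho ^+ N.+1 / 2.
  by rewrite divr_ge0// mulr_ge0 ?exprn_ge0 ?powR_ge0.
have b0 : 0 <= b by rewrite mulr_ge0// mulr_ge0 ?(ltW c00)// divr_ge0 ?sqrtr_ge0.
have p00 : 0 <= p0.
  rewrite subr_ge0 invf_le1; first by rewrite lerDl ltW// hit_const_gt0.
  by rewrite ltr_wpDr// ltW// hit_const_gt0.
have tail_b w : E w -> (b%:E <= tail_norm N w)%E.
  move=> /largeE[j jN coef_large].
  apply: (@le_trans _ _ ((T / 2 ^+ N.+1) `^ (1 / 2 - alpha) / 2
      * nrm (haar_coef T (fun t => W t w) (N.+1, j.+1)))%:E).
    rewrite lee_fin (step_powR _ T0) ler_wpM2l//.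
    rewrite (le_trans _ (nrm_c0 _))// ler_wpM2l ?(ltW c00)//.
    exact: le_trans coef_large (ler_norm _).
  rewrite -(haar_coef_tail _ T0 jN).
  exact: (holder_norm_ge_coef nrmP T0 al).
have -> : (b * p0 `^ r^-1)%:E = (((b `^ r) * p0)%:E `^ r^-1)%E.
  by rewrite poweR_EFin powRM ?powR_ge0// powRK.
apply: lee_poweR; [by rewrite invr_ge0 ltW|by rewrite lee_fin mulr_ge0 ?powR_ge0|].
apply: (@le_trans _ _ (\int[P]_w ((b `^ r)%:E * (\1_E w)%:E))%E).
  rewrite ge0_integralZl//; last 2 first.
  - by apply/measurable_EFinP; exact: measurable_indic.
  - by rewrite lee_fin powR_ge0.
  by rewrite integral_indic// setIT EFinM lee_wpmul2l// lee_fin powR_ge0.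
apply: ge0_le_integral_nonmeasurable => w.
  by rewrite mule_ge0// lee_fin powR_ge0.
rewrite indicE; case: (boolP (w \in E)) => [/set_mem Ew|_].
  rewrite mule1 -poweR_EFin; apply: lee_poweR; [exact: ltW|by rewrite lee_fin|].
  exact: tail_b.
by rewrite mule0 poweR_ge0.
Qed.

(** A coefficient of level [p] is a difference of two increments, each bounded by
    its standard deviation times [sqrt p] times the [r]-th root of the random
    variable attached to its coordinate; this bounds the coefficients of all
    levels at once, so that the deterministic estimate applies path by path. *)
Lemma tail_norm_le_sup_incr (K : R) (N : nat) (w : Omega) : (0 < d)%N -> (0 < N)%N ->
  0 < K -> (forall i : 'I_d, nrm (delta_mx ord0 i) <= K) ->
  (forall t, t \in `[0, T] ->
     schauder_trunc T (fun s => W s w) M t @[M --> \oo] --> W t w) ->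
  ((tail_norm N w) `^ r <=
   ((8 * T `^ (1 / 2 - alpha) / (1 - rho) ^+ 2 * K * Num.sqrt N%:R * rho ^+ N) `^ r
      * d%:R `^ (r - 1))%:E
   * \sum_(i < d) sup_incr_bound T W r i w)%E.
Proof.
move=> d0 N0 K0 nrmK W_lim; set G := 8 * _ * _ * _ * _ * _.
have rho0 : 0 < rho by rewrite powR_gt0.
have rho1 : rho < 1 by exact: ratio_lt1.
have G0 : 0 < G.
  have h2 : 0 < (1 - rho) ^+ 2 by rewrite exprn_gt0// subr_gt0.
  by rewrite !mulr_gt0 ?powR_gt0 ?invr_gt0 ?sqrtr_gt0 ?ltr0n ?(exprn_gt0 _ rho0).
have Gd0 : 0 < G `^ r * d%:R `^ (r - 1) by rewrite mulr_gt0 ?powR_gt0// ltr0n.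
pose S i := sup_incr_bound T W r i w.
have S0 i : (0 <= S i)%E by exact: sup_incr_bound_ge0.
(* Where some bound is infinite the right-hand side is +oo. *)
have [[i0 Si0]|Sfin] := pselect (exists i, S i = +oo%E).
  have -> : (\sum_(i < d) sup_incr_bound T W r i w = +oo)%E.
    apply/eqP; rewrite -leye_eq (bigD1 i0)//= -/(S i0) Si0.
    by rewrite leeDl// sume_ge0// => i _; exact: S0.
  by rewrite gt0_muley ?lte_fin// leey.
pose th i := fine (S i).
have thE i : S i = (th i)%:E.
  rewrite fineK// ge0_fin_numE// ltey; apply/eqP => Si; apply: Sfin.
  by exists i.
have th0 i : 0 <= th i by rewrite fine_ge0.
have incr_le p k i : (0 < p)%N -> (k < 2 ^ p.+1)%N ->
    `|grid_incr T W p.+1 k i w|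
    <= Num.sqrt (T / 2 ^+ p.+1) * (Num.sqrt p%:R * th i `^ r^-1).
  move=> p0 kp; have := le_sup_incr_bound W T0 i w r0 p0 kp.
  rewrite -/(S i) thE lee_fin; set y := _ / _ / _ => yth.
  have s0 : 0 < Num.sqrt (T / 2 ^+ p.+1) by rewrite sqrtr_gt0 divr_gt0 ?exprn_gt0.
  have sp0 : 0 < Num.sqrt p%:R :> R by rewrite sqrtr_gt0 ltr0n.
  have y0 : 0 <= y by rewrite !divr_ge0 ?sqrtr_ge0.
  have : y <= th i `^ r^-1.
    rewrite -(powRK r0 y0) ge0_ler_powR ?nnegrE ?powR_ge0 ?invr_ge0//.
    exact: ltW.
  by rewrite /y !ler_pdivrMr// mulrC [_ * Num.sqrt p%:R]mulrC.
have coef_le p j i : (0 < p)%N -> (j < 2 ^ p)%N ->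
    `|haar_coef T (fun t => W t w) (p, j.+1) ord0 i|
    <= Num.sqrt p%:R * (2 * th i `^ r^-1).
  move=> p0 jp; rewrite haar_coef_grid_incr normrM (ger0_norm (sqrtr_ge0 _)).
  have ev : (j.*2 < 2 ^ p.+1)%N by rewrite expnS mul2n ltn_double.
  have od : (j.*2.+1 < 2 ^ p.+1)%N by rewrite expnS mul2n ltn_Sdouble.
  have := lerD (incr_le _ _ i p0 ev) (incr_le _ _ i p0 od).
  set X := grid_incr _ _ _ _ _ _; set Y := grid_incr _ _ _ _ _ _ => XY.
  apply: (le_trans (ler_wpM2l (sqrtr_ge0 _) (le_trans (ler_normB X Y) XY))).
  rewrite -mulr2n -mulrnAr mulrA haar_height_step// -mulrnAr mulrCA.
  rewrite mulr_natl ler_wpM2l ?sqrtr_ge0// ler_piMl ?mulrn_wge0 ?powR_ge0//.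
  by rewrite -[leRHS]sqrtr1 ler_wsqrtr// invf_le1// ler1n.
set U := K * (2 * \sum_(i < d) th i `^ r^-1).
have coefU p j : (0 < p)%N -> (j < 2 ^ p)%N ->
    nrm (haar_coef T (fun t => W t w) (p, j.+1)) <= Num.sqrt p%:R * U.
  move=> p0 jp; apply: (le_trans (is_norm_le_coord nrmP _ nrmK)).
  rewrite /U mulrCA ler_wpM2l ?(ltW K0)// !mulr_sumr ler_sum// => i _.
  exact: coef_le.
have := holder_norm_tail_le nrmP T0 al N0 nrmK W_lim coefU.
rewrite -/(tail_norm N w) -/rho => tail_le.
apply: (le_trans (lee_poweR (ltW r0) (tail_norm_ge0 N w) tail_le)).
rewrite poweR_EFin (eq_bigr (fun i => (th i)%:E)) => [|i _]; last exact: thE.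
rewrite sumEFin -EFinM lee_fin.
rewrite (_ : _ * rho ^+ N = G * \sum_(i < d) th i `^ r^-1); last first.
  by rewrite /G /U; field; rewrite subr_eq0 gt_eqF.
rewrite powRM ?(ltW G0) ?sumr_ge0//; last by move=> i _; exact: powR_ge0.
rewrite -mulrA ler_wpM2l ?powR_ge0//.
apply: (le_trans (powR_sum_le r1 d0 (fun i => powR_ge0 _ _))).
rewrite ler_wpM2l ?powR_ge0// ler_sum// => i _.
by rewrite -powRrM mulVf ?powRr1// gt_eqF.
Qed.

Lemma moment_upper_bound (K : R) (N : nat) : (0 < d)%N -> (0 < N)%N ->
  0 < K -> (forall i : 'I_d, nrm (delta_mx ord0 i) <= K) ->
  {ae P, forall w, forall t, t \in `[0, T] ->
     schauder_trunc T (fun s => W s w) M t @[M --> \oo] --> W t w} ->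
  ((\int[P]_w (tail_norm N w) `^ r) `^ r^-1 <=
   (8 * T `^ (1 / 2 - alpha) / (1 - rho) ^+ 2 * K * Num.sqrt N%:R * rho ^+ N
    * d%:R * (4 `^ r + 4 * Num.sqrt 2 * (4 * r) `^ (r / 2)) `^ r^-1)%:E)%E.
Proof.
move=> d0 N0 K0 nrmK W_lim; set G := 8 * _ * _ * _ * _ * _.
set B := 4 `^ r + _.
have B0 : 0 <= B by rewrite addr_ge0 ?powR_ge0// !mulr_ge0 ?sqrtr_ge0 ?powR_ge0.
have G0 : 0 <= G.
  by rewrite !mulr_ge0 ?powR_ge0 ?invr_ge0 ?sqr_ge0 ?sqrtr_ge0 ?exprn_ge0 ?powR_ge0 ?(ltW K0).
have dd0 : 0 <= d%:R :> R by [].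
have -> : (G * d%:R * B `^ r^-1)%:E = ((G `^ r * d%:R `^ (r - 1) * (d%:R * B))%:E `^ r^-1)%E.
  rewrite poweR_EFin (_ : _ * (d%:R * B) = (G * d%:R) `^ r * B); last first.
    by rewrite powRM// -(mulr_powRB1 dd0 r0); ring.
  by rewrite powRM ?powR_ge0// powRK// mulr_ge0.
apply: lee_poweR.
- by rewrite invr_ge0 ltW.
- by apply: integral_ge0 => w _; exact: poweR_ge0.
have mS i : measurable_fun setT (sup_incr_bound T W r i).
  exact: (measurable_sup_incr_bound T0 bm).
have S0 i w : (0 <= sup_incr_bound T W r i w)%E by exact: sup_incr_bound_ge0.
set D := G `^ r * d%:R `^ (r - 1).
have D0 : 0 <= D by rewrite mulr_ge0 ?powR_ge0.
apply: (@le_trans _ _ (\int[P]_w (D%:E * \sum_(i < d) sup_incr_bound T W r i w))%E).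
  apply: ae_le_integral_nonmeasurable.
  - by move=> w; exact: poweR_ge0.
  - by move=> w; rewrite mule_ge0 ?lee_fin// sume_ge0.
  - by apply: measurable_funeM; exact: emeasurable_sum.
  - by apply: filterS W_lim => w Wlim_w; exact: tail_norm_le_sup_incr.
rewrite ge0_integralZl//; last 2 first.
- exact: emeasurable_sum.
- by move=> w _; rewrite sume_ge0.
rewrite ge0_integral_sum// [leRHS]EFinM lee_wpmul2l ?lee_fin//.
apply: (@le_trans _ _ (\sum_(i < d) B%:E)%E).
  by apply: lee_sum => i _; exact: integral_sup_incr_bound_le.
by rewrite sumEFin sumr_const card_ord mulr_natl.
Qed.

End moment_bounds.

Theorem proposition3p2 (R : realType) (T : R) (hT : 0 < T)
    (alpha : R) (halpha : 0 < alpha < 1 / 2) (r : R) (hr : 1 < r) (K : R) :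
  exists2 C : R, 0 < C &
  forall (d : nat) (nrm : 'rV[R]_d -> R), (0 < d)%N -> is_norm nrm ->
    (forall i : 'I_d, nrm (delta_mx ord0 i) <= K) ->
  exists2 c : R, 0 < c &
  forall (disp : measure_display) (Omega : measurableType disp)
    (P : probability Omega R) (W : R -> Omega -> 'rV[R]_d),
    is_brownian_motion P T W ->
    {ae P, forall w, forall t, t \in `[0, T] ->
      schauder_trunc T (fun s => W s w) N t @[N --> \oo] --> W t w} ->
  forall N : nat, (0 < N)%N ->
    ((c * d%:R * N%:R `^ (1 / 2 - alpha) * 2 `^ ((alpha - 1 / 2) * N%:R))%:E
      <= (\int[P]_w
            (holder_norm nrm T alpha
               (fun t => W t w - schauder_trunc T (fun s => W s w) N t)%R) `^ r)
         `^ r^-1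
      <= (C * d%:R * Num.sqrt N%:R * 2 `^ ((alpha - 1 / 2) * N%:R))%:E)%E.
Proof.
set rho : R := 2 `^ (alpha - 1 / 2).
have rho0 : 0 < rho by rewrite powR_gt0.
have rho1 : rho < 1 by exact: ratio_lt1.
have rhoN N : 2 `^ ((alpha - 1 / 2) * N%:R) = rho ^+ N.
  by rewrite powRrM powR_mulrn ?powR_ge0.
pose K' := `|K| + 1; have K'0 : 0 < K' by rewrite ltr_wpDl.
pose B : R := 4 `^ r + 4 * Num.sqrt 2 * (4 * r) `^ (r / 2).
have B0 : 0 < B.
  by rewrite ltr_wpDr ?powR_gt0// !mulr_ge0 ?sqrtr_ge0 ?powR_ge0.
exists (8 * T `^ (1 / 2 - alpha) / (1 - rho) ^+ 2 * K' * B `^ r^-1).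
  have h2 : 0 < (1 - rho) ^+ 2 by rewrite exprn_gt0// subr_gt0.
  by rewrite !mulr_gt0 ?powR_gt0 ?invr_gt0.
move=> d nrm d0 nrmP nrmK.
have nrmK' i : nrm (delta_mx ord0 i) <= K'.
  by rewrite (le_trans (nrmK i))// (le_trans (ler_norm K))// lerDl.
have [c0 c00 nrm_c0] := is_norm_coord_lower nrmP.
pose p0 : R := 1 - (1 + hit_const)^-1.
have p00 : 0 < p0.
  by rewrite subr_gt0 invf_lt1 ?ltrDl ?addr_gt0 ?hit_const_gt0.
have dR0 : 0 < d%:R :> R by rewrite ltr0n.
exists (T `^ (1 / 2 - alpha) * rho * c0 * p0 `^ r^-1 / 8 / d%:R).
  by rewrite !mulr_gt0 ?powR_gt0 ?invr_gt0.
move=> disp Omega P W bm W_lim N N0; rewrite !rhoN; apply/andP; split.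
  apply: le_trans (moment_lower_bound nrmP hT halpha hr bm (i := Ordinal d0) N c00 _); last first.
    by move=> u; exact: nrm_c0.
  rewrite lee_fin -/rho -/p0 exprS.
  set c := _ / 8 / _; rewrite (_ : c * d%:R = T `^ (1 / 2 - alpha) * rho * c0 * p0 `^ r^-1 / 8); last first.
    by rewrite /c mulfVK// gt_eqF.
  have N_sqrt : N%:R `^ (1 / 2 - alpha) <= Num.sqrt N%:R :> R.
    rewrite -powR12_sqrt// ler_powR ?ler1n//.
    by case/andP: halpha => ? _; rewrite mul1r lerBlDr lerDl ltW.
  rewrite [leRHS](_ : _ = T `^ (1 / 2 - alpha) * rho * c0 * p0 `^ r^-1 / 8
      * Num.sqrt N%:R * rho ^+ N); last by field.
  rewrite ler_wpM2r ?exprn_ge0 ?(ltW rho0)// ler_wpM2l//.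
  by rewrite !mulr_ge0 ?powR_ge0 ?(ltW c00).
apply: le_trans (moment_upper_bound nrmP hT halpha hr bm d0 N0 K'0 nrmK' W_lim) _.
rewrite lee_fin -/rho -/B le_eqVlt; apply/orP; left; apply/eqP.
by field; rewrite subr_eq0 gt_eqF.
Qed.
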